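(* Consider the procedure (described in the context) of unique recovery of the potential $\{C_k\}$ of the discrete skew-selfadjoint Dirac system $y_{k+1}(z)=(I_m+\frac{\mathrm{i}}{z}C_k)y_k(z)$, $C_k=U_k^*jU_k$ ($U_k$ unitary, $k\in\mathbb{N}_0$), from a minimal realization of its Weyl function (i.e., of some strictly proper rational $m_1\times m_2$ matrix function). Assume that $\mathrm{i}\notin\sigma(\alpha)$, where $\alpha$ is the matrix recovered in this procedure. Then the procedure is stable. That is: let $\varphi(z)=\mathcal{C}(zI_n-\mathcal{A})^{-1}\mathcal{B}$ be a minimal realization of a strictly proper rational $m_1\times m_2$ matrix function such that the recovered $\alpha$ satisfies $\mathrm{i}\notin\sigma(\alpha)$, and let $\{C_k\}$ be the recovered potential. Then for every $\varepsilon>0$ there is $\delta>0$ such that for every triple $\{\widetilde{\mathcal{A}},\widetilde{\mathcal{B}},\widetilde{\mathcal{C}}\}$ of matrices of the same respective sizes, giving a minimal realization $\widetilde\varphi(z)=\widetilde{\mathcal{C}}(zI_n-\widetilde{\mathcal{A}})^{-1}\widetilde{\mathcal{B}}$ and satisfying $\|\mathcal{A}-\widetilde{\mathcal{A}}\|+\|\mathcal{B}-\widetilde{\mathcal{B}}\|+\|\mathcal{C}-\widetilde{\mathcal{C}}\|<\delta$, the potential $\{\widetilde C_k\}$ recovered from $\{\widetilde{\mathcal{A}},\widetilde{\mathcal{B}},\widetilde{\mathcal{C}}\}$ satisfies $$\sup_{k\in\mathbb{N}_0}\|C_k-\widetilde C_k\|<\varepsilon.$$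
   Context: $\|\cdot\|$ is the $\ell^2$-induced matrix norm; $\sigma(\alpha)$ is the spectrum of $\alpha$; $\mathbb{N}_0=\{0,1,2,\dots\}$; $X>0$ means that $X$ is Hermitian with all eigenvalues positive. $m=m_1+m_2$, $j=\mathrm{diag}\{I_{m_1},-I_{m_2}\}$. Weyl function of the system: an $m_1\times m_2$ matrix function $\varphi(z)$ such that, for some $M>0$ and all $z$ with $\Im z>M$, $$\sum_{k=0}^\infty\begin{bmatrix}\varphi(z)^*&I_{m_2}\end{bmatrix}w_k(z)^*w_k(z)\begin{bmatrix}\varphi(z)\\ I_{m_2}\end{bmatrix}<\infty,$$ where $w_k(z)$ is the fundamental solution of the system with $w_0(z)\equiv I_m$. A rational matrix function is strictly proper if it tends to zero at infinity. A realization $\varphi(z)=\mathcal{C}(zI_n-\mathcal{A})^{-1}\mathcal{B}$ ($\mathcal{A}$ of size $n\times n$, $\mathcal{B}$ of size $n\times m_2$, $\mathcal{C}$ of size $m_1\times n$) is minimal if $n$ is minimal among all realizations of $\varphi$; equivalently, $\mathrm{span}\bigcup_{k=0}^{n-1}\mathrm{Im}(\mathcal{A}^k\mathcal{B})=\mathbb{C}^n$ and $\mathrm{span}\bigcup_{k=0}^{n-1}\mathrm{Im}((\mathcal{A}^* )^k\mathcal{C}^* )=\mathbb{C}^n$. Recovery procedure: given a minimal realization, let $X>0$ be the positive solution (it exists and is unique, by known results) of $$X\mathcal{C}^*\mathcal{C}X-\mathrm{i}(\mathcal{A}X-X\mathcal{A}^* )-\mathcal{B}\mathcal{B}^*=0,$$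 put $\alpha=-\mathcal{A}+\mathrm{i}\mathcal{B}\mathcal{B}^*X^{-1}$, $S_0=X$, $\vartheta_1=X\mathcal{C}^*$, $\vartheta_2=\mathrm{i}\mathcal{B}$, and set $$C_k=j+\Lambda_k^*S_k^{-1}\Lambda_k-\Lambda_{k+1}^*S_{k+1}^{-1}\Lambda_{k+1},$$ $$\Lambda_0=\begin{bmatrix}\vartheta_1&\vartheta_2\end{bmatrix},\quad \Lambda_{k+1}=\Lambda_k+\mathrm{i}\alpha^{-1}\Lambda_kj,\quad S_{k+1}=S_k+\alpha^{-1}S_k(\alpha^* )^{-1}+\alpha^{-1}\Lambda_kj\Lambda_k^*(\alpha^* )^{-1}.$$ By known results, $\alpha$ is invertible, all $S_k>0$, each $C_k$ has the form $U_k^*jU_k$ with $U_k$ unitary, and $\varphi$ is the Weyl function of the system with this potential. *)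

(* Defs.v *)
From mathcomp Require Import all_boot all_order all_algebra.
From mathcomp Require Import complex.
From mathcomp Require Import classical_sets reals constructive_ereal ereal.

Set Implicit Arguments.
Unset Strict Implicit.
Unset Printing Implicit Defensive.

Import Order.TTheory GRing.Theory Num.Theory.
Local Open Scope ring_scope.
Local Open Scope sesquilinear_scope.

Section Norms.
Variable R : realType.

Definition vec_norm (n : nat) (x : 'cV[R[i]]_n) : R :=
  Num.sqrt (\sum_(k < n) ComplexField.Normc.normc (x k ord0) ^+ 2).

(* The set is nonempty and bounded in every dimension, 0 included, so [sup] is
   a genuine supremum. *)
Definition mx_norm2 (m n : nat) (A : 'M[R[i]]_(m, n)) : R :=
  sup [set r : R | exists2 x : 'cV[R[i]]_n,
                     vec_norm x <= 1 & r = vec_norm (A *m x)]%classic.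

Definition mx_posdef (n : nat) (X : 'M[R[i]]_n) : Prop :=
  X \is hermsymmx /\ forall a : R[i], eigenvalue X a -> 0 < a.

End Norms.

Section Realizations.
Variable R : realType.

(* Rational functions are formal fractions of polynomials. *)
Definition cst_mx (m n : nat) (A : 'M[R[i]]_(m, n)) :
    'M[{fraction {poly R[i]}}]_(m, n) :=
  map_mx (fun a : R[i] => tofrac a%:P) A.

(* Cc (z I - A)^-1 B.  The rational matrix functions of this form are exactly
   the strictly proper ones; z I - A is invertible over the field of fractions
   because its determinant is monic. *)
Definition transfer (n m1 m2 : nat) (A : 'M[R[i]]_n) (B : 'M[R[i]]_(n, m2))
    (Cc : 'M[R[i]]_(m1, n)) : 'M[{fraction {poly R[i]}}]_(m1, m2) :=
  cst_mx Cc *m invmx ((tofrac 'X)%:M - cst_mx A) *m cst_mx B.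

Definition minimal_realization (n m1 m2 : nat)
    (phi : 'M[{fraction {poly R[i]}}]_(m1, m2))
    (A : 'M[R[i]]_n) (B : 'M[R[i]]_(n, m2)) (Cc : 'M[R[i]]_(m1, n)) : Prop :=
  phi = transfer A B Cc /\
  forall (n' : nat) (A' : 'M[R[i]]_n') (B' : 'M[R[i]]_(n', m2))
         (Cc' : 'M[R[i]]_(m1, n')),
    phi = transfer A' B' Cc' -> (n <= n')%N.

End Realizations.

Section Recovery.
Variables (R : realType) (n m1 m2 : nat).

Definition jmx : 'M[R[i]]_(m1 + m2) := block_mx 1%:M 0 0 (- 1%:M).

Definition positive_riccati_solution (A : 'M[R[i]]_n) (B : 'M[R[i]]_(n, m2))
    (Cc : 'M[R[i]]_(m1, n)) (X : 'M[R[i]]_n) : Prop :=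
  mx_posdef X /\
  X *m Cc^t* *m Cc *m X - 'i *: (A *m X - X *m A^t*) - B *m B^t* = 0.

Definition recovered_alpha (A : 'M[R[i]]_n) (B : 'M[R[i]]_(n, m2))
    (X : 'M[R[i]]_n) : 'M[R[i]]_n :=
  - A + 'i *: (B *m B^t* *m invmx X).

(* [invmx] is the identity on singular matrices; for a positive solution X of a
   minimal realization, alpha and all S_k are invertible, so this case is void. *)
Fixpoint Lambda_seq (alpha : 'M[R[i]]_n) (Lambda0 : 'M[R[i]]_(n, m1 + m2))
    (k : nat) : 'M[R[i]]_(n, m1 + m2) :=
  if k is k'.+1 then
    let L := Lambda_seq alpha Lambda0 k' in
    L + 'i *: (invmx alpha *m L *m jmx)
  else Lambda0.

Fixpoint S_seq (alpha : 'M[R[i]]_n) (Lambda0 : 'M[R[i]]_(n, m1 + m2))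
    (S0 : 'M[R[i]]_n) (k : nat) : 'M[R[i]]_n :=
  if k is k'.+1 then
    let S := S_seq alpha Lambda0 S0 k' in
    let L := Lambda_seq alpha Lambda0 k' in
    S + invmx alpha *m S *m invmx (alpha^t*)
      + invmx alpha *m L *m jmx *m L^t* *m invmx (alpha^t*)
  else S0.

Definition recovered_potential (A : 'M[R[i]]_n) (B : 'M[R[i]]_(n, m2))
    (Cc : 'M[R[i]]_(m1, n)) (X : 'M[R[i]]_n) (k : nat) : 'M[R[i]]_(m1 + m2) :=
  let alpha := recovered_alpha A B X in
  let L := Lambda_seq alpha (row_mx (X *m Cc^t*) ('i *: B)) in
  let S := S_seq alpha (row_mx (X *m Cc^t*) ('i *: B)) X in
  jmx + (L k)^t* *m invmx (S k) *m L k
      - (L k.+1)^t* *m invmx (S k.+1) *m L k.+1.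

End Recovery.

(* Main.v *)
Require Import Defs.
From mathcomp Require Import all_boot all_order all_algebra.
From mathcomp Require Import complex.
From mathcomp Require Import classical_sets reals constructive_ereal ereal.
From mathcomp Require Import filter ring lra.

(** Cayley transformation turns every Lyapunov identity
    [a D - D a^* = i E] of the problem into a Stein identity
    [D - T D T^* = 2 J E J^*] with [J = (a + i)^-1] and [T = J (a - i)].
    Controllability and observability make the relevant [T] power stable
    ([|T^N| < 1] for some [N]); this survives perturbation, and bounds [D] by
    [D - T D T^*], in norm and from above as a quadratic form.

    With [P = 1 + i alpha^-1] one has [Lambda_k = P^k L_k] and
    [S_k = P^k R_k P^k^*], where [L_k = [theta_1, T^k theta_2]] is bounded and
    [R_k - T R_k T^* = 2 J L_k L_k^* J^*].  Hence
    [C_k = j + Q_k - Q_(k+1)] with [Q_k = L_k^* R_k^-1 L_k], and [R_k] is bounded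
    below, uniformly in [k], by an observability Gramian: all ingredients
    depend continuously on [alpha] and [X], uniformly in [k].

    For the continuity of [X], put [K = X C^*] and complete the square in the
    perturbed equation: this gives a Lyapunov identity for [D = X~ - X] whose
    right-hand side is a small term independent of [X~], minus a square, so
    [D <= eps].  The same applied to the dual system [(A^*, C^*, B^*, X^-1)]
    bounds [D] from below. *)

Set Implicit Arguments.
Unset Strict Implicit.
Unset Printing Implicit Defensive.

Import Order.TTheory GRing.Theory Num.Theory.
Import ComplexField.Normc.
Local Open Scope ring_scope.
Local Open Scope sesquilinear_scope.

(** * Algebra of conjugate transposes *)

Section Adjoint.
Variable C : numClosedFieldType.

Lemma ctrD m n (A B : 'M[C]_(m, n)) : (A + B)^t* = A^t* + B^t*.
Proof. by rewrite linearD map_mxD. Qed.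

Lemma ctrN m n (A : 'M[C]_(m, n)) : (- A)^t* = - A^t*.
Proof. by rewrite linearN map_mxN. Qed.

Lemma ctrM m n p (A : 'M[C]_(m, n)) (B : 'M[C]_(n, p)) :
  (A *m B)^t* = B^t* *m A^t*.
Proof. by rewrite trmx_mul map_mxM. Qed.

Lemma ctrZ m n (a : C) (A : 'M[C]_(m, n)) : (a *: A)^t* = a^* *: A^t*.
Proof. by rewrite linearZ map_mxZ. Qed.

Lemma ctr_scalar n (a : C) : (a%:M : 'M[C]_n)^t* = a^*%:M.
Proof. by rewrite tr_scalar_mx map_scalar_mx. Qed.

Lemma ctr1 n : (1%:M : 'M[C]_n)^t* = 1%:M.
Proof. by rewrite ctr_scalar rmorph1. Qed.

Lemma ctr0 m n : (0 : 'M[C]_(m, n))^t* = 0.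
Proof. by rewrite trmx0 map_mx0. Qed.

Lemma ctr_inv n (A : 'M[C]_n) : (invmx A)^t* = invmx (A^t*).
Proof. by rewrite trmx_inv map_invmx. Qed.

Lemma unitmx_ctr n (A : 'M[C]_n) : (A^t* \in unitmx) = (A \in unitmx).
Proof. by rewrite map_unitmx unitmx_tr. Qed.

Lemma ctrX n (A : 'M[C]_n) k : (A ^+ k)^t* = A^t* ^+ k.
Proof.
elim: k => [|k IHk]; first by rewrite !expr0 ctr1.
by rewrite exprS exprSr -!mulmxE ctrM IHk.
Qed.

Lemma ctr_sum m n (I : Type) (r : seq I) (F : I -> 'M[C]_(m, n)) :
  (\sum_(i <- r) F i)^t* = \sum_(i <- r) (F i)^t*.
Proof. by rewrite !raddf_sum. Qed.

Lemma ctr_row_mx m n1 n2 (A : 'M[C]_(m, n1)) (B : 'M[C]_(m, n2)) :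
  (row_mx A B)^t* = col_mx (A^t*) (B^t*).
Proof. by rewrite tr_row_mx map_col_mx. Qed.

End Adjoint.

(** * A submultiplicative entrywise norm *)

Section EntryNorm.
Variable R : realType.
Local Notation C := R[i].

Lemma ler_normcD (x y : C) : normc (x + y) <= normc x + normc y.
Proof. exact: le_normcD. Qed.

Lemma normcNE (x : C) : normc (- x) = normc x.
Proof. exact: normcN. Qed.

Lemma normc_ge0 (x : C) : 0 <= normc x.
Proof. by case: x => a b; apply: sqrtr_ge0. Qed.

Lemma normc_conj (x : C) : normc x^* = normc x.
Proof. by case: x => a b /=; rewrite sqrrN. Qed.

Lemma sqr_normcE (x : C) : normc x ^+ 2 = complex.Re x ^+ 2 + complex.Im x ^+ 2.
Proof. by case: x => a b /=; rewrite sqr_sqrtr // addr_ge0 ?sqr_ge0. Qed.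

Lemma ler_normc_Re (x : C) : `|complex.Re x| <= normc x.
Proof.
rewrite -(ler_pXn2r (_ : 0 < 2)%N) ?nnegrE ?normc_ge0 ?normr_ge0 //.
by rewrite sqr_normcE real_normK ?num_real // lerDl sqr_ge0.
Qed.

Lemma ler_normc_sum (I : Type) (r : seq I) (F : I -> C) :
  normc (\sum_(i <- r) F i) <= \sum_(i <- r) normc (F i).
Proof.
elim/big_rec2: _ => [|i y x _ le_xy]; first by rewrite normc0.
by apply: le_trans (ler_normcD _ _) _; rewrite lerD2l.
Qed.

(** This norm carries all the estimates: it is submultiplicative for rectangular matrices, invariant
    under adjoints, and can be bounded entry by entry. It is equivalent to the induced norm in fixed
    dimension ([mx_norm2_le], [nrm_le_mx_norm2]), which suffices for continuity. *)
Definition nrm m n (A : 'M[C]_(m, n)) : R := \sum_i \sum_j normc (A i j).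

Lemma nrm_ge0 m n (A : 'M[C]_(m, n)) : 0 <= nrm A.
Proof. by apply: sumr_ge0 => i _; apply: sumr_ge0 => j _; apply: normc_ge0. Qed.
Hint Resolve nrm_ge0 : core.

Lemma nrm0 m n : nrm (0 : 'M[C]_(m, n)) = 0.
Proof. by apply: big1 => i _; apply: big1 => j _; rewrite mxE normc0. Qed.

Lemma nrm_entry m n (A : 'M[C]_(m, n)) i j : normc (A i j) <= nrm A.
Proof.
rewrite /nrm (bigD1 i) //= (bigD1 j) //= -addrA lerDl addr_ge0 ?sumr_ge0 //.
  by move=> k _; apply: normc_ge0.
by move=> k _; apply: sumr_ge0 => l _; apply: normc_ge0.
Qed.

Lemma nrm_eq0 m n (A : 'M[C]_(m, n)) : nrm A <= 0 -> A = 0.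
Proof.
move=> A_le0; apply/matrixP=> i j; rewrite mxE; apply: eq0_normc.
by apply/eqP; rewrite eq_le normc_ge0 (le_trans (nrm_entry _ _ _)).
Qed.

Lemma nrmD m n (A B : 'M[C]_(m, n)) : nrm (A + B) <= nrm A + nrm B.
Proof.
rewrite -big_split ler_sum // => i _; rewrite -big_split ler_sum // => j _.
by rewrite mxE ler_normcD.
Qed.

Lemma nrmN m n (A : 'M[C]_(m, n)) : nrm (- A) = nrm A.
Proof. by apply: eq_bigr => i _; apply: eq_bigr => j _; rewrite mxE normcNE. Qed.

Lemma nrmZ m n (a : C) (A : 'M[C]_(m, n)) : nrm (a *: A) = normc a * nrm A.
Proof.
rewrite mulr_sumr; apply: eq_bigr => i _; rewrite mulr_sumr.
by apply: eq_bigr => j _; rewrite mxE normcM.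
Qed.

Lemma nrm_ctr m n (A : 'M[C]_(m, n)) : nrm (A^t*) = nrm A.
Proof.
rewrite /nrm exchange_big; apply: eq_bigr => i _; apply: eq_bigr => j _.
by rewrite !mxE normc_conj.
Qed.

Lemma nrmM m n p (A : 'M[C]_(m, n)) (B : 'M[C]_(n, p)) :
  nrm (A *m B) <= nrm A * nrm B.
Proof.
rewrite mulr_suml ler_sum // => i _.
apply: (@le_trans _ _ (\sum_j \sum_k normc (A i k) * normc (B k j))).
  apply: ler_sum => j _; rewrite mxE (le_trans (ler_normc_sum _ _)) //.
  by apply: ler_sum => k _; rewrite normcM.
rewrite exchange_big mulr_suml ler_sum // => k _; rewrite -mulr_sumr.
rewrite ler_wpM2l ?normc_ge0 // /nrm (bigD1 k) //= lerDl sumr_ge0 // => l _.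
by apply: sumr_ge0 => j _; apply: normc_ge0.
Qed.

Lemma nrm_row_mx m n1 n2 (A : 'M[C]_(m, n1)) (B : 'M[C]_(m, n2)) :
  nrm (row_mx A B) = nrm A + nrm B.
Proof.
rewrite -big_split; apply: eq_bigr => i _; rewrite big_split_ord /=.
by congr (_ + _); apply: eq_bigr => j _; rewrite ?row_mxEl ?row_mxEr.
Qed.

Lemma nrm_le_entries m n (A : 'M[C]_(m, n)) c :
  (forall i j, normc (A i j) <= c) -> nrm A <= m%:R * n%:R * c.
Proof.
move=> A_le; apply: (@le_trans _ _ (\sum_(i < m) \sum_(j < n) c)).
  by apply: ler_sum => i _; apply: ler_sum => j _.
by rewrite !sumr_const !card_ord -mulrA !mulr_natl.
Qed.

Lemma nrmM_le m n p (A : 'M[C]_(m, n)) (B : 'M[C]_(n, p)) a b :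
  nrm A <= a -> nrm B <= b -> nrm (A *m B) <= a * b.
Proof. by move=> Aa Bb; apply: le_trans (nrmM _ _) _; apply: ler_pM. Qed.

Lemma nrm_sum m n (I : Type) (r : seq I) (F : I -> 'M[C]_(m, n)) :
  nrm (\sum_(i <- r) F i) <= \sum_(i <- r) nrm (F i).
Proof.
elim/big_rec2: _ => [|i y x _ le_xy]; first by rewrite nrm0.
by apply: le_trans (nrmD _ _) _; rewrite lerD2l.
Qed.

End EntryNorm.
#[global] Hint Extern 0 (is_true (0 <= nrm _)) => solve [apply: nrm_ge0] : core.

(** * Quadratic forms on row vectors and the Cauchy-Schwarz inequality *)

Section QuadraticForm.
Variable R : realType.
Local Notation C := R[i].

(* The real part makes [qf] additive in [H] and real valued without assuming [H]
   Hermitian. *)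
Definition qf n (H : 'M[C]_n) (v : 'rV[C]_n) : R :=
  complex.Re ((v *m H *m v^t*) 0 0).
Definition sq n (v : 'rV[C]_n) : R := qf 1%:M v.

Lemma ReD (x y : C) : complex.Re (x + y) = complex.Re x + complex.Re y.
Proof. by case: x; case: y. Qed.

Lemma ReN (x : C) : complex.Re (- x) = - complex.Re x.
Proof. by case: x. Qed.

Lemma qfD n (H K : 'M[C]_n) v : qf (H + K) v = qf H v + qf K v.
Proof. by rewrite /qf mulmxDr mulmxDl mxE ReD. Qed.

Lemma qfN n (H : 'M[C]_n) v : qf (- H) v = - qf H v.
Proof. by rewrite /qf mulmxN mulNmx mxE ReN. Qed.

Lemma qfB n (H K : 'M[C]_n) v : qf (H - K) v = qf H v - qf K v.
Proof. by rewrite qfD qfN. Qed.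

Lemma qf0 n v : qf (0 : 'M[C]_n) v = 0.
Proof. by rewrite /qf mulmx0 mul0mx mxE. Qed.

Lemma qf_sum n (I : Type) (r : seq I) (F : I -> 'M[C]_n) v :
  qf (\sum_(i <- r) F i) v = \sum_(i <- r) qf (F i) v.
Proof.
by elim/big_rec2: _ => [|i y x _ <-]; rewrite ?qf0 ?qfD.
Qed.

Lemma qfZ n (H : 'M[C]_n) (a : R) v : qf (a%:C%C *: H) v = a * qf H v.
Proof.
rewrite /qf -scalemxAr -scalemxAl mxE; case: (_ 0 0) => x y.
by rewrite /= mul0r subr0.
Qed.

Lemma qf_congr n p (T : 'M[C]_(p, n)) (H : 'M[C]_n) v :
  qf (T *m H *m T^t*) v = qf H (v *m T).
Proof. by rewrite /qf ctrM !mulmxA. Qed.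

Lemma sqE n (v : 'rV[C]_n) : sq v = \sum_j normc (v 0 j) ^+ 2.
Proof.
rewrite /sq /qf mulmx1 mxE.
rewrite (big_morph (@complex.Re R) ReD (erefl : complex.Re (0 : C) = 0)).
apply: eq_bigr => j _; rewrite !mxE sqr_normcE; case: (v 0 j) => x y /=.
by rewrite mulrN opprK !expr2.
Qed.

Lemma sq_ge0 n (v : 'rV[C]_n) : 0 <= sq v.
Proof. by rewrite sqE sumr_ge0 // => j _; rewrite sqr_ge0. Qed.
Hint Resolve sq_ge0 : core.

Lemma sq_entry n (v : 'rV[C]_n) j : normc (v 0 j) ^+ 2 <= sq v.
Proof.
by rewrite sqE (bigD1 j) //= lerDl sumr_ge0 // => k _; rewrite sqr_ge0.
Qed.

Lemma sq_eq0 n (v : 'rV[C]_n) : sq v <= 0 -> v = 0.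
Proof.
move=> v0; apply/rowP=> j; rewrite mxE; apply: eq0_normc.
apply/eqP; rewrite -sqrf_eq0 eq_le sqr_ge0 andbT.
exact: le_trans (sq_entry v j) v0.
Qed.

Lemma sq_gt0 n (v : 'rV[C]_n) : v != 0 -> 0 < sq v.
Proof. by move=> v0; rewrite ltNge; apply: contra v0 => /sq_eq0 ->. Qed.

Lemma sq_row_mx m n (v : 'rV[C]_m) (w : 'rV[C]_n) :
  sq (row_mx v w) = sq v + sq w.
Proof.
rewrite !sqE big_split_ord /=.
by congr (_ + _); apply: eq_bigr => i _; rewrite ?row_mxEl ?row_mxEr.
Qed.

Lemma qf_gram n p (G : 'M[C]_(n, p)) v : qf (G *m G^t*) v = sq (v *m G).
Proof. by rewrite -[G in G *m _]mulmx1 qf_congr. Qed.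

Lemma qf_ler n (H : 'M[C]_n) v : `|qf H v| <= nrm H * sq v.
Proof.
apply: le_trans (ler_normc_Re _) _; rewrite mxE.
under eq_bigr do rewrite !mxE mulr_suml.
apply: le_trans (ler_normc_sum _ _) _.
apply: le_trans (ler_sum _ (fun i _ => ler_normc_sum _ _)) _.
rewrite exchange_big mulr_suml; apply: ler_sum => i _; rewrite mulr_suml.
apply: ler_sum => j _; rewrite !normcM normc_conj mulrAC mulrC.
rewrite ler_wpM2l ?normc_ge0 //.
have := sq_entry v i; have := sq_entry v j.
have := sqr_ge0 (normc (v 0 i) - normc (v 0 j)); nra.
Qed.

Lemma qf_le n (H : 'M[C]_n) v : qf H v <= nrm H * sq v.
Proof. exact: le_trans (ler_norm _) (qf_ler H v). Qed.

Lemma sq_mul n p (v : 'rV[C]_n) (G : 'M[C]_(n, p)) :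
  sq (v *m G) <= nrm G ^+ 2 * sq v.
Proof.
rewrite -qf_gram (le_trans (qf_le _ _)) // ler_wpM2r //.
by rewrite (le_trans (nrmM _ _)) // nrm_ctr.
Qed.

Lemma qf_herm n (H : 'M[C]_n) v : H^t* = H -> (v *m H *m v^t*) 0 0 = (qf H v)%:C%C.
Proof.
move=> Hh; have : (v *m H *m v^t*)^t* = v *m H *m v^t*.
  by rewrite !ctrM trmxCK Hh mulmxA.
move=> /matrixP/(_ 0 0); rewrite 2!mxE /qf; case: (_ 0 0) => x y [] /eqP.
by rewrite eq_sym -subr_eq0 opprK -mulr2n mulrn_eq0 /= => /eqP ->.
Qed.

Definition pd n (H : 'M[C]_n) : Prop :=
  H^t* = H /\ forall v, v != 0 -> 0 < qf H v.

Lemma pd_ge0 n (H : 'M[C]_n) v : pd H -> 0 <= qf H v.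
Proof.
move=> [_ Hp]; have [->|/Hp/ltW //] := eqVneq v 0.
by rewrite /qf !mul0mx mxE.
Qed.

Lemma pd_CS n (H : 'M[C]_n) v w : pd H ->
  normc ((v *m H *m w^t*) 0 0) ^+ 2 <= qf H v * qf H w.
Proof.
move=> [Hh Hp]; have [->|w0] := eqVneq w 0.
  by rewrite ctr0 mulmx0 mxE normc0 expr0n /= {2}/qf mul0mx mul0mx mxE /= mulr0.
have {w0}s_gt0 := Hp w w0; set s := qf H w in s_gt0 *.
set z := (_ 0 0).
have zE : (v *m H *m w^t*) = z%:M by apply/matrixP=> i j; rewrite !ord1 [RHS]mxE mulr1n.
have zE' : (w *m H *m v^t*) = z^*%:M.
  by rewrite -ctr_scalar -zE !ctrM trmxCK Hh mulmxA.
have sE : w *m H *m w^t* = (s%:C%C)%:M.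
  by apply/matrixP=> i j; rewrite !ord1 [RHS]mxE mulr1n qf_herm.
have tE : v *m H *m v^t* = ((qf H v)%:C%C)%:M.
  by apply/matrixP=> i j; rewrite !ord1 [RHS]mxE mulr1n qf_herm.
(* At this vector the form equals [s * (s * qf H v - |z|^2)], and [s > 0] can be divided out. *)
have := @pd_ge0 n H (s%:C%C *: v - z *: w) (conj Hh Hp).
rewrite {1}/qf ctrD ctrN !ctrZ !(mulmxDl, mulmxDr, mulmxN, mulNmx).
rewrite -!(scalemxAl, scalemxAr) zE zE' sE tE !mxE /= sqr_normcE; case: z {zE zE'} => x y /= h.
have : 0 <= s * (s * qf H v - (x ^+ 2 + y ^+ 2)).
  apply: le_trans h _; rewrite le_eqVlt; apply/orP; left; apply/eqP; ring.
by rewrite pmulr_rge0 // subr_ge0 mulrC.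
Qed.

End QuadraticForm.

Lemma unitmx_inj (F : fieldType) n (M : 'M[F]_n) :
  (forall v : 'rV_n, v *m M = 0 -> v = 0) -> M \in unitmx.
Proof.
move=> inj; rewrite -row_free_unit -kermx_eq0; apply/eqP/row_matrixP=> i.
by rewrite row0; apply: inj; rewrite -row_mul mulmx_ker row0.
Qed.

(** Bernoulli's inequality in the form [(1 - d)^k (1 + k d) <= 1] makes the decay explicit. *)
Lemma exists_expr_le (R : realType) (q e : R) : 0 <= q -> q < 1 -> 0 < e ->
  exists k, q ^+ k <= e.
Proof.
move=> q0 q1 e0; pose d := 1 - q.
have d0 : 0 < d by rewrite subr_gt0.
have bernoulli k : q ^+ k * (1 + k%:R * d) <= 1.
  elim: k => [|k]; first by rewrite expr0 mul0r addr0 mul1r.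
  apply: le_trans; rewrite exprSr -mulrA ler_wpM2l ?exprn_ge0 //.
  have := mulr_ge0 (ler0n R k) (sqr_ge0 d); have := sqr_ge0 d.
  by rewrite -natr1 (_ : q = 1 - d) ?expr2; [nra | rewrite /d; ring].
pose k := Num.truncn (e^-1 / d).
have kP : e^-1 < k.+1%:R * d.
  by rewrite -ltr_pdivrMr // truncnS_gt.
exists k.+1; have := bernoulli k.+1; have := exprn_ge0 k.+1 q0.
move: (q ^+ _) => x x0 h; have : x * e^-1 <= 1.
  by apply: le_trans h; rewrite ler_wpM2l // (le_trans (ltW kP)) // lerDr.
by rewrite ler_pdivrMr // mul1r.
Qed.

(** * Coercivity, inverses and norm bounds obtained from forms *)

Section Definite.
Variables (R : realType).
Local Notation C := R[i].

Lemma sq_delta n (i : 'I_n) : sq (delta_mx 0 i : 'rV[C]_n) = 1.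
Proof.
rewrite sqE (bigD1 i) //= big1 => [|j ji]; first by rewrite mxE !eqxx normc1 expr1n addr0.
by rewrite mxE (negPf ji) andbF normc0 expr0n.
Qed.

Lemma pd_unit n (H : 'M[C]_n) : pd H -> H \in unitmx.
Proof.
move=> [_ Hp]; apply: unitmx_inj => v vH; have [//|/Hp] := eqVneq v 0.
by rewrite /qf vH mul0mx mxE ltxx.
Qed.

(** Cauchy-Schwarz for [v] and [v *m invmx H] gives [sq v ^+ 2 <= qf H v * qf (invmx H) v], whose
    last factor is at most [nrm (invmx H) * sq v]. Adding 1 to that norm keeps the constant positive
    in dimension 0. *)
Lemma pd_lower n (H : 'M[C]_n) : pd H ->
  exists2 c : R, 0 < c & forall v, c * sq v <= qf H v.
Proof.
move=> Hpd; have Hu := pd_unit Hpd; have [Hh Hp] := Hpd.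
exists (nrm (invmx H) + 1)^-1; first by rewrite invr_gt0 ltr_wpDl.
move=> v; rewrite mulrC ler_pdivrMr ?ltr_wpDl //.
have [->|v0] := eqVneq v 0; first by rewrite /sq /qf !mul0mx mxE /= mul0r.
have sv := sq_gt0 v0; have qv := Hp v v0.
have := pd_CS v (v *m invmx H) Hpd.
rewrite -qf_congr mulVmx // mul1mx ctr_inv Hh.
rewrite ctrM ctr_inv Hh !mulmxA mulmxK //.
have -> : (v *m v^t*) 0 0 = (sq v)%:C%C.
  by rewrite -(qf_herm v (ctr1 _ n)) mulmx1.
rewrite /= expr0n /= addr0 sqrtr_sqr ger0_norm ?sq_ge0 // => h.
have h2 := qf_le (invmx H) v.
have : sq v * sq v <= sq v * (qf H v * nrm (invmx H)).
  by rewrite -expr2 (le_trans h) // mulrCA ler_wpM2l ?(ltW qv) // mulrC.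
by rewrite ler_pM2l // => h3; rewrite mulrDr mulr1 (le_trans h3) // lerDl (ltW qv).
Qed.

Lemma lower_unit n (H : 'M[C]_n) c : 0 < c -> (forall v, c * sq v <= qf H v) ->
  H \in unitmx.
Proof.
move=> c0 Hc; apply: unitmx_inj => v vH; apply: sq_eq0.
by have := Hc v; rewrite {1}/qf vH mul0mx mxE /= pmulr_rle0.
Qed.

(** For a row [w] of the inverse, [w *m H] is a basis vector, so [c * sq w <= |w_i|]. Hence
    [|w_i| <= 1/c], and then every entry of [w] is at most [1/c]. The bound depends on [H] only
    through [c], hence is uniform over a family with a common [c]. *)
Lemma nrm_inv_lower n (H : 'M[C]_n) c : 0 < c ->
  (forall v, c * sq v <= qf H v) -> nrm (invmx H) <= n%:R * n%:R * c^-1.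
Proof.
move=> c0 Hc; apply: nrm_le_entries => i j; pose w := row i (invmx H).
have -> : invmx H i j = w 0 j by rewrite mxE.
have wE : w = delta_mx 0 i *m invmx H by rewrite -rowE.
have h1 : c * sq w <= normc (w 0 i).
  apply: le_trans (Hc w) _; rewrite /qf wE mulmxKV ?(lower_unit c0 Hc) // -wE.
  rewrite -rowE !mxE -[normc _]normc_conj.
  exact: le_trans (ler_norm _) (ler_normc_Re _).
have h2 := sq_entry w i; have h3 := sq_entry w j.
have [t0 s0] := (normc_ge0 (w 0 i), normc_ge0 (w 0 j)).
have t1 : normc (w 0 i) <= c^-1.
  have : normc (w 0 i) * (c * normc (w 0 i)) <= normc (w 0 i) * 1.
    rewrite mulrCA mulr1 -expr2; apply: le_trans h1; rewrite ler_wpM2l // ltW //.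
  move: t0; rewrite le_eqVlt => /orP [/eqP <- _|t0]; first by rewrite invr_ge0 ltW.
  by rewrite ler_pM2l // mulrC -ler_pdivlMr // mul1r.
rewrite -(ler_pXn2r (_ : 0 < 2)%N) ?nnegrE // ?invr_ge0 ?(ltW c0) //.
apply: le_trans h3 _; rewrite expr2 ler_pdivlMl //.
exact: le_trans t1.
Qed.

(** The shift [D + 2c] is positive definite with diagonal at most [3c], so Cauchy-Schwarz on basis
    vectors bounds its entries by [3c]; undoing the shift costs another [2c]. *)
Lemma nrm_herm_le n (D : 'M[C]_n) c : D^t* = D -> 0 < c ->
  (forall v, `|qf D v| <= c * sq v) -> nrm D <= n%:R * n%:R * (5 * c).
Proof.
move=> Dh c0 Dc; apply: nrm_le_entries => i j.
pose H := D + ((2 * c)%:C%C)%:M.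
have qH v : qf H v = qf D v + 2 * c * sq v.
  by rewrite qfD -[_%:M]mulmx1 mul_scalar_mx qfZ.
have Hpd : pd H.
  split; first by rewrite ctrD Dh ctr_scalar; congr (_ + _%:M); apply/conjc_real.
  move=> v /sq_gt0 sv; rewrite qH; have := Dc v; rewrite ler_norml => /andP[h _].
  by have := mulr_gt0 c0 sv; lra.
have qd k : qf H (delta_mx 0 k) <= 3 * c.
  rewrite qH; have := Dc (delta_mx 0 k); rewrite sq_delta ler_norml => /andP[_ h].
  by lra.
have := pd_CS (delta_mx 0 i) (delta_mx 0 j) Hpd.
rewrite trmx_delta map_delta_mx -rowE -colE mxE mxE => h.
have qp k : 0 <= qf H (delta_mx 0 k).
  apply/ltW; apply: (proj2 Hpd); apply/eqP => /(congr1 (@sq R n)).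
  by rewrite sq_delta /sq /qf !mul0mx mxE => /eqP; rewrite oner_eq0.
have h2 : normc (H i j) <= 3 * c.
  rewrite -(ler_pXn2r (_ : 0 < 2)%N) ?nnegrE ?normc_ge0 ?mulr_ge0 ?(ltW c0) //.
  by apply: le_trans h _; rewrite expr2; apply: ler_pM.
have -> : D i j = H i j - (((2 * c)%:C%C)%:M : 'M[C]_n) i j by rewrite mxE addrK.
apply: le_trans (ler_normcD _ _) _; rewrite normcNE.
have : normc ((((2 * c)%:C%C)%:M : 'M[C]_n) i j) <= 2 * c; last by lra.
rewrite mxE; case: (i == j); rewrite ?mulr1n ?mulr0n ?normc0 ?mulr_ge0 ?(ltW c0) //.
by rewrite /= expr0n addr0 sqrtr_sqr ger0_norm // mulr_ge0 ?(ltW c0).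
Qed.

(** In a unitary diagonalization the rows of [P] are eigenvectors, so the diagonal is positive and
    the form is a positively weighted sum of squares. *)
Lemma posdef_pd n (X : 'M[C]_n) : mx_posdef X -> pd X.
Proof.
move=> [Xh Xe]; have XA : X^t* = X.
  by have /is_hermitianmxP := Xh; rewrite expr0 scale1r => {2}->.
split=> // v v0; have /hermitian_normalmx/orthomx_spectralP := Xh.
set P := spectralmx X; set d := spectral_diag X => XE.
have Pu : P \in unitmx := spectral_unit X.
have Pt : invmx P = P^t* := invmx_unitary (spectral_unitarymx X).
have d_gt0 i : 0 < d 0 i.
  apply: Xe; apply/eigenvalueP; exists (row i P).
    rewrite rowE {1}XE !mulmxA -(mulmxA _ P) mulmxV // mulmx1 -(rowE i (diag_mx d)).
    by rewrite row_diag_mx -scalemxAl.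
  apply/eqP => /(congr1 (mulmx^~ (invmx P))).
  rewrite mul0mx -row_mul mulmxV // => /rowP/(_ i)/eqP.
  by rewrite !mxE eqxx oner_eq0.
pose w := v *m P^t*.
have w0 : w != 0.
  by apply: contra v0 => /eqP w0; rewrite -(mulmxKV Pu v) Pt -/w w0 mul0mx.
have -> : qf X v = \sum_j complex.Re (d 0 j) * normc (w 0 j) ^+ 2.
  rewrite XE Pt -{2}[P]trmxCK qf_congr -/w; move: (w) => u; rewrite /qf mxE.
  rewrite (big_morph (@complex.Re R) (@ReD R) (erefl : complex.Re (0 : C) = 0)).
  apply: eq_bigr => j _; rewrite mul_mx_diag !mxE sqr_normcE.
  have := gtr0_real (d_gt0 j); case: (d 0 j) => a b; rewrite complex_real => /eqP ->.
  by case: (u 0 j) => x y /=; ring.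
have /rV0Pn[j wj] := w0.
have Red k : 0 < complex.Re (d 0 k).
  by have := d_gt0 k; rewrite ltcE => /andP[_].
rewrite (bigD1 j) //= ltr_pwDl ?sumr_ge0 // => [|k _].
  rewrite mulr_gt0 // exprn_gt0 // lt_neqAle normc_ge0 andbT.
  by apply: contra wj => /eqP/esym/eq0_normc ->.
by rewrite mulr_ge0 ?sqr_ge0 // ltW.
Qed.

End Definite.

(** By Cayley-Hamilton, [T ^+ k] is the value at [T] of the remainder of ['X^k] modulo the
    characteristic polynomial. *)
Lemma mxpow_span (F : fieldType) n (T : 'M[F]_n) k :
  exists c : nat -> F, T ^+ k = \sum_(l < n) c l *: T ^+ l.
Proof.
case: n T => [|n] T; first by exists (fun=> 0); rewrite [LHS]flatmx0 [RHS]flatmx0.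
pose p := 'X^k %% char_poly T; exists (fun i => p`_i).
have sz : (size p <= n.+1)%N.
  by rewrite -ltnS -(size_char_poly T) ltn_modp -size_poly_eq0 size_char_poly.
have pE : p = \sum_(l < n.+1) p`_l *: 'X^l.
  rewrite -poly_def; apply/polyP=> i; rewrite coef_poly; case: ltnP => // lei.
  by rewrite nth_default // (leq_trans sz).
have -> : T ^+ k = horner_mx T p.
  rewrite -{1}(horner_mx_X T) -rmorphXn [in LHS](divp_eq 'X^k (char_poly T)).
  by rewrite rmorphD rmorphM /= Cayley_Hamilton mulr0 add0r.
rewrite {1}pE rmorph_sum; apply: eq_bigr => i _.
by rewrite /= horner_mxZ rmorphXn /= horner_mx_X.
Qed.

(** * Stein equations and power stability *)

Section Stein.
Variables (R : realType).
Local Notation C := R[i].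

Lemma stein_iter n (T D : 'M[C]_n) N :
  D = T ^+ N *m D *m (T ^+ N)^t*
      + \sum_(l < N) T ^+ l *m (D - T *m D *m T^t*) *m (T ^+ l)^t*.
Proof.
elim: N => [|N IHN].
  by rewrite big_ord0 addr0 expr0 ctr1 mul1mx mulmx1.
rewrite big_ord_recr /=.
have -> : T ^+ N *m (D - T *m D *m T^t*) *m (T ^+ N)^t*
  = T ^+ N *m D *m (T ^+ N)^t* - T ^+ N.+1 *m D *m (T ^+ N.+1)^t*.
  by rewrite mulmxBr mulmxBl exprSr -!mulmxE ctrM !mulmxA.
by rewrite [RHS]addrC -addrA subrK addrC -IHN.
Qed.

(** There is one term more than Cayley-Hamilton asks for, so that the horizon [n.+1] is positive
    even when [n = 0]. *)
Definition gramian n p (T : 'M[C]_n) (G : 'M[C]_(n, p)) : 'M[C]_n :=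
  \sum_(l < n.+1) T ^+ l *m (G *m G^t*) *m (T ^+ l)^t*.

Lemma gramian_pd n p (T : 'M[C]_n) (G : 'M[C]_(n, p)) :
  (forall v : 'rV_n, (forall k, v *m T ^+ k *m G = 0) -> v = 0) ->
  pd (gramian T G).
Proof.
move=> TG; split=> [|v v0].
  rewrite /gramian ctr_sum; apply: eq_bigr => l _.
  by rewrite !ctrM !trmxCK !mulmxA.
rewrite /gramian qf_sum lt_neqAle sumr_ge0 ?andbT => [|l _]; last first.
  by rewrite qf_congr qf_gram sq_ge0.
apply: contra v0 => /eqP/esym/eqP; rewrite psumr_eq0 => [/allP sum0|l _]; last first.
  by rewrite qf_congr qf_gram sq_ge0.
have vTG l : (l < n)%N -> v *m T ^+ l *m G = 0.
  move=> ln; have := sum0 (widen_ord (leqnSn n) (Ordinal ln)) (mem_index_enum _).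
  by rewrite /= qf_congr qf_gram => /eqP h; apply: sq_eq0; rewrite h.
apply/eqP/TG => k; have [c ->] := mxpow_span T k.
rewrite mulmx_sumr mulmx_suml big1 // => l _.
by rewrite -scalemxAr -scalemxAl vTG ?ltn_ord // scaler0.
Qed.

(** This says that the spectral radius is below 1. The threshold 1/4 leaves room for perturbation: a
    nearby matrix has its [N]-th power below 1/4 + 1/4, as [contr] requires. *)
Definition pstab n (T : 'M[C]_n) : Prop :=
  exists2 N, (0 < N)%N & nrm (T ^+ N) <= 4^-1.

Lemma pstab_ctr n (T : 'M[C]_n) : pstab T -> pstab (T^t*).
Proof. by case=> N N0 TN; exists N; rewrite // -ctrX nrm_ctr. Qed.

(** [qf X] is a Lyapunov function: over [n.+1] steps it loses the Gramian form, which is at least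
    the fraction [c / M] of it. It therefore decays geometrically, and coercivity of [X] transfers
    the decay to the entries of the powers. *)
Lemma pstab_gram n p (T X : 'M[C]_n) (G : 'M[C]_(n, p)) :
  pd X -> X - T *m X *m T^t* = G *m G^t* ->
  (forall v : 'rV_n, (forall k, v *m T ^+ k *m G = 0) -> v = 0) -> pstab T.
Proof.
move=> Xpd XT TG.
have [b b0 bX] := pd_lower Xpd.
have [c c0 cH] := pd_lower (gramian_pd TG).
pose M := nrm X + c + 1.
have M0 : 0 < M by rewrite ltr_wpDl // addr_ge0 // ltW.
have XM v : qf X v <= M * sq v.
  rewrite (le_trans (qf_le X v)) // ler_wpM2r ?sq_ge0 // /M -addrA lerDl.
  by rewrite addr_ge0 // ltW.
pose N := n.+1; pose q := 1 - c / M.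
have q0 : 0 <= q.
  by rewrite subr_ge0 ler_pdivrMr // mul1r /M -addrA addrCA lerDl addr_ge0.
have q1 : q < 1 by rewrite gtrDl oppr_lt0 divr_gt0.
have step v : qf X (v *m T ^+ N) <= q * qf X v.
  have := stein_iter T X N; rewrite XT -/(gramian T G) => /(congr1 (fun H => qf H v)).
  rewrite /= qfD qf_congr => h.
  have h2 : c / M * qf X v <= qf (gramian T G) v.
    apply: le_trans (cH v); rewrite -mulrA ler_wpM2l ?(ltW c0) //.
    by rewrite ler_pdivrMl.
  by rewrite /q mulrBl mul1r; lra.
have iter k v : qf X (v *m T ^+ (N * k)) <= q ^+ k * qf X v.
  elim: k v => [|k IHk] v; first by rewrite muln0 !expr0 mulmx1 mul1r.
  rewrite mulnS exprD -mulmxE mulmxA (le_trans (IHk _)) // exprSr -mulrA.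
  by rewrite ler_wpM2l ?exprn_ge0.
(* Entries of size at most [e] give [nrm] at most [n * n * e <= 1/4]. *)
pose e := (4 * (n%:R * n%:R + 1))^-1 : R.
have e0 : 0 < e by rewrite invr_gt0 mulr_gt0 // ltr_wpDl // mulr_ge0.
have [k kP] : exists k, q ^+ k <= b * e ^+ 2 / M.
  by apply: exists_expr_le; rewrite // divr_gt0 // mulr_gt0 // exprn_gt0.
exists (N * k.+1)%N => //; apply: (@le_trans _ _ (n%:R * n%:R * e)); last first.
  have m0 : 0 <= n%:R * n%:R :> R by rewrite mulr_ge0.
  by rewrite ler_pdivrMr; lra.
apply: nrm_le_entries => i j.
rewrite -(ler_pXn2r (_ : 0 < 2)%N) ?nnegrE ?normc_ge0 ?(ltW e0) //.
have -> : (T ^+ (N * k.+1)) i j = row i (T ^+ (N * k.+1)) 0 j by rewrite mxE.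
rewrite (le_trans (sq_entry _ _)) // rowE -(ler_pM2l b0) (le_trans (bX _)) //.
rewrite (le_trans (iter _ _)) //.
apply: (@le_trans _ _ (q ^+ k.+1 * M)).
  by rewrite ler_wpM2l ?exprn_ge0 // (le_trans (XM _)) // sq_delta mulr1.
rewrite -ler_pdivlMr // (le_trans _ kP) // exprS ler_piMl ?exprn_ge0 //.
exact: ltW.
Qed.

(* Quantitative form of [pstab], with constants shared by nearby matrices. *)
Definition contr n N (M : R) (T : 'M[C]_n) : Prop :=
  [/\ (0 < N)%N, nrm (T ^+ N) <= 2^-1 & forall l, (l < N)%N -> nrm (T ^+ l) <= M].

Lemma pstab_contr n (T : 'M[C]_n) : pstab T ->
  exists N M, contr N M T /\ nrm (T ^+ N) <= 4^-1.
Proof.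
case=> N N0 TN; exists N, (\sum_(l < N) nrm (T ^+ l)); split=> //; split=> //.
  by apply: le_trans TN _; lra.
move=> l lN; rewrite (bigD1 (Ordinal lN)) //= lerDl.
by apply: sumr_ge0 => i _.
Qed.

Section Contraction.
Variables (n N : nat) (M : R) (T : 'M[C]_n).
Hypothesis contrT : contr N M T.

Lemma contr_ge0 : 0 <= M.
Proof. by have [N0 _ /(_ _ N0)] := contrT; apply: le_trans. Qed.

Lemma contr_pow k : nrm (T ^+ k) <= M.
Proof.
have [N0 TN TM] := contrT; elim/ltn_ind: k => k IHk.
have [kN|Nk] := ltnP k N; first exact: TM.
have {}IHk : nrm (T ^+ (k - N)) <= M by apply: IHk; rewrite ltn_subrL N0 (leq_trans N0).
rewrite -(subnKC Nk) exprD -mulmxE (le_trans (nrmM_le TN IHk)) //.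
by have := contr_ge0; lra.
Qed.

(** After [N] steps of [stein_iter] the remainder is at most [nrm D / 4] and is absorbed on the
    left; the resulting factor 4/3 is rounded up to 2. *)
Lemma stein_nrm (D : 'M[C]_n) :
  nrm D <= 2 * N%:R * M ^+ 2 * nrm (D - T *m D *m T^t*).
Proof.
have [N0 TN TM] := contrT; have := stein_iter T D N.
set F := D - _ => DE.
have h1 : nrm (T ^+ N *m D *m (T ^+ N)^t*) <= 2^-1 * nrm D * 2^-1.
  by apply: nrmM_le; rewrite ?nrm_ctr //; apply: nrmM_le.
have h2 : nrm (\sum_(l < N) T ^+ l *m F *m (T ^+ l)^t*) <= N%:R * (M * nrm F * M).
  rewrite (le_trans (nrm_sum _ _)) // mulr_natl -[X in _ *+ X]card_ord -sumr_const.
  apply: ler_sum => l _; apply: nrmM_le; rewrite ?nrm_ctr ?TM //.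
  by apply: nrmM_le; rewrite ?TM.
have h3 := nrmD (T ^+ N *m D *m (T ^+ N)^t*)
  (\sum_(l < N) T ^+ l *m F *m (T ^+ l)^t*).
rewrite -DE in h3; have -> : 2 * N%:R * M ^+ 2 * nrm F = 2 * (N%:R * (M * nrm F * M)).
  by ring.
by have := nrm_ge0 D; lra.
Qed.

(** With only a one-sided bound the remainder cannot be absorbed. Instead the [N]-step inequality is
    iterated [k] times: the contributions form a geometric series and the remainder
    [nrm D * 4^-1 ^+ k] tends to 0. *)
Lemma stein_upper (D : 'M[C]_n) c : 0 <= c ->
  (forall v, qf (D - T *m D *m T^t*) v <= c * sq v) ->
  forall v, qf D v <= 2 * N%:R * M ^+ 2 * c * sq v.
Proof.
have [N0 TN TM] := contrT; have := stein_iter T D N.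
set F := D - _ => DE c0 Fc.
pose K := N%:R * M ^+ 2 * c.
have K0 : 0 <= K by rewrite mulr_ge0 // mulr_ge0 // sqr_ge0.
have step v : qf D v <= qf D (v *m T ^+ N) + K * sq v.
  rewrite {1}DE qfD qf_congr lerD2l qf_sum /K -!mulrA mulr_natl.
  rewrite -[X in _ *+ X]card_ord -sumr_const; apply: ler_sum => l _.
  rewrite qf_congr (le_trans (Fc _)) //.
  rewrite (_ : M * _ = c * (M ^+ 2 * sq v)) ?ler_wpM2l //; last by ring.
  rewrite (le_trans (sq_mul _ _)) // ler_wpM2r ?sq_ge0 // ler_sqr ?TM ?nnegrE //.
  exact: contr_ge0.
have sqT v : sq (v *m T ^+ N) <= 4^-1 * sq v.
  rewrite (le_trans (sq_mul _ _)) // ler_wpM2r ?sq_ge0 //.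
  by have := nrm_ge0 (T ^+ N); nra.
have iter k v : qf D v <= (nrm D * 4^-1 ^+ k + 2 * K) * sq v.
  elim: k v => [|k IHk] v.
    rewrite expr0 mulr1 (le_trans (qf_le _ _)) // ler_wpM2r ?sq_ge0 //.
    by rewrite lerDl mulr_ge0.
  rewrite (le_trans (step v)) // (le_trans (lerD (IHk _) (lexx _))) //.
  set x := nrm D * _; have x0 : 0 <= x by rewrite mulr_ge0 // exprn_ge0.
  have := ler_wpM2l (addr_ge0 x0 (mulr_ge0 (ler0n R 2) K0)) (sqT v).
  rewrite (_ : nrm D * 4^-1 ^+ k.+1 = x * 4^-1); last by rewrite /x exprSr mulrA.
  by have := mulr_ge0 K0 (sq_ge0 v); nra.
move=> v; rewrite (_ : _ * sq v = 2 * K * sq v); last by rewrite /K; ring.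
apply/ler_addgt0Pr => d d0; pose a := nrm D * sq v + 1.
have a0 : 0 < a by rewrite ltr_wpDl // mulr_ge0 // sq_ge0.
have [k kP] : exists k, 4^-1 ^+ k <= d / a.
  by apply: exists_expr_le; [lra | lra | rewrite divr_gt0].
rewrite (le_trans (iter k v)) // mulrDl addrC lerD2l.
rewrite mulrAC; apply: (@le_trans _ _ (a * 4^-1 ^+ k)).
  by rewrite ler_wpM2r ?exprn_ge0 ?invr_ge0 // lerDl.
by rewrite mulrC -ler_pdivlMr.
Qed.

End Contraction.

End Stein.

(** * Calculus of limits uniform in the index *)

Section UniformLimits.
Variables (R : realType) (I : Type) (F : set_system I).
Context {FF : Filter F}.
Local Notation C := R[i].

(* Convergence along [F], uniform in the index [k]. *)
Definition ucv m n (f : I -> nat -> 'M[C]_(m, n)) (g : nat -> 'M[C]_(m, n)) :=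
  forall e : R, 0 < e -> \forall t \near F, forall k, nrm (f t k - g k) <= e.

Definition bnd m n (g : nat -> 'M[C]_(m, n)) := exists b : R, forall k, nrm (g k) <= b.

Lemma bnd_pos m n (g : nat -> 'M[C]_(m, n)) : bnd g ->
  exists2 b : R, 0 < b & forall k, nrm (g k) <= b.
Proof.
case=> b gb; exists (b + 1) => [|k]; last by rewrite (le_trans (gb k)) // lerDl.
by rewrite ltr_wpDl // (le_trans _ (gb 0%N)).
Qed.

Lemma bnd_cst m n (A : 'M[C]_(m, n)) : bnd (fun=> A).
Proof. by exists (nrm A). Qed.

Lemma bndM m n p (f : nat -> 'M[C]_(m, n)) (g : nat -> 'M[C]_(n, p)) :
  bnd f -> bnd g -> bnd (fun k => f k *m g k).
Proof. by case=> a fa [b gb]; exists (a * b) => k; apply: nrmM_le. Qed.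

Lemma bnd_ctr m n (f : nat -> 'M[C]_(m, n)) : bnd f -> bnd (fun k => (f k)^t*).
Proof. by case=> b fb; exists b => k; rewrite nrm_ctr. Qed.

Lemma bnd_row_mx m n1 n2 (f : nat -> 'M[C]_(m, n1)) (g : nat -> 'M[C]_(m, n2)) :
  bnd f -> bnd g -> bnd (fun k => row_mx (f k) (g k)).
Proof. by case=> a fa [b gb]; exists (a + b) => k; rewrite nrm_row_mx lerD. Qed.

Lemma bnd_pow n (T : 'M[C]_n) : pstab T -> bnd (fun k => T ^+ k).
Proof.
by move=> /pstab_contr [N [M [cT _]]]; exists M => k; apply: contr_pow cT k.
Qed.

Lemma ucv_cst m n (g : nat -> 'M[C]_(m, n)) : ucv (fun=> g) g.
Proof. by move=> e e0; apply: nearW => t k; rewrite subrr nrm0 ltW. Qed.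

Lemma ucv_eq_lim m n (f : I -> nat -> 'M[C]_(m, n)) g g' :
  (forall k, g k = g' k) -> ucv f g -> ucv f g'.
Proof. by move=> gg' h e /h; apply: filterS => t {}h k; rewrite -gg'. Qed.

Lemma ucv_near_eq m n (f f' : I -> nat -> 'M[C]_(m, n)) g :
  (\forall t \near F, forall k, f t k = f' t k) -> ucv f g -> ucv f' g.
Proof.
by move=> ff' h e /h; apply: filterS2 ff' => t tt' {}h k; rewrite -tt'.
Qed.

Lemma ucvD m n (f1 f2 : I -> nat -> 'M[C]_(m, n)) g1 g2 :
  ucv f1 g1 -> ucv f2 g2 -> ucv (fun t k => f1 t k + f2 t k) (fun k => g1 k + g2 k).
Proof.
move=> h1 h2 e e0; have e2 : 0 < e / 2 by rewrite divr_gt0.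
apply: filterS2 (h1 _ e2) (h2 _ e2) => t {}h1 {}h2 k.
rewrite opprD addrACA (le_trans (nrmD _ _)) // (splitr e) lerD //.
Qed.

Lemma ucvN m n (f : I -> nat -> 'M[C]_(m, n)) g :
  ucv f g -> ucv (fun t k => - f t k) (fun k => - g k).
Proof.
move=> h e /h; apply: filterS => t {}h k.
by rewrite -opprD nrmN.
Qed.

Lemma ucvB m n (f1 f2 : I -> nat -> 'M[C]_(m, n)) g1 g2 :
  ucv f1 g1 -> ucv f2 g2 -> ucv (fun t k => f1 t k - f2 t k) (fun k => g1 k - g2 k).
Proof. by move=> h1 /ucvN; apply: ucvD. Qed.

Lemma ucv_ctr m n (f : I -> nat -> 'M[C]_(m, n)) g :
  ucv f g -> ucv (fun t k => (f t k)^t*) (fun k => (g k)^t*).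
Proof.
by move=> h e /h; apply: filterS => t {}h k; rewrite -ctrN -ctrD nrm_ctr.
Qed.

Lemma ucvM m n p (f1 : I -> nat -> 'M[C]_(m, n)) (f2 : I -> nat -> 'M[C]_(n, p)) g1 g2 :
  bnd g1 -> bnd g2 -> ucv f1 g1 -> ucv f2 g2 ->
  ucv (fun t k => f1 t k *m f2 t k) (fun k => g1 k *m g2 k).
Proof.
move=> /bnd_pos [a a0 ga] /bnd_pos [b b0 gb] h1 h2 e e0.
have e1 : 0 < e / 2 / b by rewrite !divr_gt0.
have e2 : 0 < e / 2 / (a + 1) by rewrite !divr_gt0 // addr_gt0.
(* The third use, with tolerance 1, bounds [f1 t k] by [a + 1]. *)
apply: filterS3 (h1 _ e1) (h2 _ e2) (h1 _ ltr01) => t {}h1 {}h2 h3 k.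
have -> : f1 t k *m f2 t k - g1 k *m g2 k =
    (f1 t k - g1 k) *m g2 k + f1 t k *m (f2 t k - g2 k).
  by rewrite mulmxBl mulmxBr [RHS]addrC addrA subrK.
rewrite (le_trans (nrmD _ _)) // (splitr e) lerD //.
  by rewrite -[leRHS](divfK (lt0r_neq0 b0)) nrmM_le.
rewrite -[leRHS](divfK (lt0r_neq0 (addr_gt0 a0 ltr01))) mulrC nrmM_le //.
rewrite -(subrK (g1 k) (f1 t k)) addrC (le_trans (nrmD _ _)) // lerD //.
Qed.

Lemma ucvZ m n a (f : I -> nat -> 'M[C]_(m, n)) g :
  ucv f g -> ucv (fun t k => a *: f t k) (fun k => a *: g k).
Proof.
move=> h e e0; have e1 : 0 < e / (normc a + 1).
  by rewrite divr_gt0 // ltr_wpDl // normc_ge0.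
apply: filterS (h _ e1) => t {}h k; rewrite -scalerBr nrmZ.
have a1 : 0 < normc a + 1 by rewrite ltr_wpDl // normc_ge0.
rewrite -[leRHS](divfK (lt0r_neq0 a1)) mulrC ler_pM ?normc_ge0 //.
by rewrite lerDl.
Qed.

Lemma ucv_row_mx m n1 n2 (f1 : I -> nat -> 'M[C]_(m, n1))
    (f2 : I -> nat -> 'M[C]_(m, n2)) g1 g2 :
  ucv f1 g1 -> ucv f2 g2 ->
  ucv (fun t k => row_mx (f1 t k) (f2 t k)) (fun k => row_mx (g1 k) (g2 k)).
Proof.
move=> h1 h2 e e0; have e2 : 0 < e / 2 by rewrite divr_gt0.
apply: filterS2 (h1 _ e2) (h2 _ e2) => t {}h1 {}h2 k.
by rewrite opp_row_mx add_row_mx nrm_row_mx (splitr e) lerD.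
Qed.

Lemma ucv_shift m n (f : I -> nat -> 'M[C]_(m, n)) g :
  ucv f g -> ucv (fun t k => f t k.+1) (fun k => g k.+1).
Proof. by move=> h e /h; apply: filterS => t {}h k. Qed.

(** If [v] is in the left kernel of [f t k], then [v = v (g - f) g^-1], so [nrm v <= nrm v / 2] and
    [v = 0]. Convergence follows from [f^-1 - g^-1 = - f^-1 (f - g) g^-1]. Uniformity in [k] comes
    from the common bound on the inverses of the limits. *)
Lemma ucv_inv n (f : I -> nat -> 'M[C]_n) g :
  bnd (fun k => invmx (g k)) -> (forall k, g k \in unitmx) -> ucv f g ->
  (\forall t \near F, forall k, f t k \in unitmx) /\
  ucv (fun t k => invmx (f t k)) (fun k => invmx (g k)).
Proof.
move=> /bnd_pos [b b0 gb] gu h.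
have near_unit : \forall t \near F, forall k, f t k \in unitmx.
  have e0 : 0 < b^-1 / 2 by rewrite divr_gt0 // invr_gt0.
  apply: filterS (h _ e0) => t {}h k; apply: unitmx_inj => v vf.
  have vE : v = v *m (g k - f t k) *m invmx (g k).
    by rewrite mulmxBr vf subr0 mulmxK.
  have := nrmM_le (nrmM_le (lexx (nrm v)) (h k)) (gb k).
  rewrite -[f t k - g k]opprB mulmxN mulNmx nrmN -vE mulrA -[X in _ <= X]mulrA.
  rewrite [2^-1 * b]mulrC mulrA mulfVK ?lt0r_neq0 // => hv.
  by apply: nrm_eq0; have := nrm_ge0 v; lra.
(* The first bound yields [nrm (invmx (f t k)) <= 2 * b]; the second then makes [2 * b * d * b] at
   most [e]. *)
split=> // e e0; pose d := Num.min (b^-1 / 2) (e / (2 * b * b)).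
have d0 : 0 < d by rewrite lt_min !divr_gt0 // ?invr_gt0 ?mulr_gt0.
apply: filterS2 (h _ d0) near_unit => t {}h fu k.
have hk := h k; rewrite le_min in hk; case/andP: hk => hk1 hk2.
have E : invmx (f t k) - invmx (g k) = - (invmx (f t k) *m (f t k - g k) *m invmx (g k)).
  by rewrite mulmxBr mulVmx // mulmxBl mul1mx mulmxK ?opprB // -mulmxA mulmxV ?mulmx1.
have h1 : nrm (invmx (f t k)) <= 2 * b.
  have h2 := nrmM_le (nrmM_le (lexx (nrm (invmx (f t k)))) hk1) (gb k).
  have h3 := nrmD (invmx (f t k) - invmx (g k)) (invmx (g k)).
  rewrite subrK E nrmN in h3; have h4 := gb k.
  have : nrm (invmx (f t k)) * (b^-1 / 2) * b = nrm (invmx (f t k)) / 2.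
    by field; apply: lt0r_neq0.
  by move=> h5; rewrite h5 in h2; lra.
rewrite E nrmN (le_trans (nrmM_le (nrmM_le h1 hk2) (gb k))) //.
by rewrite le_eqVlt; apply/orP; left; apply/eqP; field; apply: lt0r_neq0.
Qed.

Section Stable.
Variables (n : nat) (S : I -> 'M[C]_n) (T : 'M[C]_n).
Hypotheses (stabT : pstab T) (ST : ucv (fun t _ => S t) (fun=> T)).

Lemma ucv_pow_fix l : ucv (fun t _ => S t ^+ l) (fun=> T ^+ l).
Proof.
elim: l => [|l IHl]; first exact: ucv_cst.
rewrite exprS -mulmxE.
apply: (ucv_near_eq _ (ucvM (bnd_cst _) (bnd_cst _) ST IHl)).
by apply: nearW => t _; rewrite mulmxE -exprS.
Qed.

Lemma near_ltn (P : I -> nat -> Prop) N :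
  (forall l, \forall t \near F, P t l) ->
  \forall t \near F, forall l, (l < N)%N -> P t l.
Proof.
move=> PP; elim: N => [|N IHN]; first exact: nearW.
apply: filterS2 IHN (PP N) => t h hN l; rewrite ltnS leq_eqVlt.
by case/orP => [/eqP ->|/h].
Qed.

(** Only the finitely many powers up to [N] matter, and each depends continuously on the matrix. *)
Lemma near_contr : exists N M, contr N M T /\ \forall t \near F, contr N M (S t).
Proof.
have [N [M [[N0 TN2 TM] TN]]] := pstab_contr stabT; exists N, (M + 1).
split; first by split=> // l /TM h; rewrite (le_trans h) // lerDl.
have q0 : 0 < 4^-1 :> R by [].
apply: filterS2 (near_ltn N (fun l => ucv_pow_fix l ltr01)) (ucv_pow_fix N q0).
move=> t h1 h2; split=> // [|l lN].
  rewrite -(subrK (T ^+ N) (S t ^+ N)) (le_trans (nrmD _ _)) //.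
  apply: le_trans (lerD (h2 0%N) TN) _.
  by rewrite [leRHS](_ : _ = 4^-1 + 4^-1) //; field.
rewrite -(subrK (T ^+ l) (S t ^+ l)) (le_trans (nrmD _ _)) //.
by rewrite addrC lerD ?TM ?(h1 l lN 0%N).
Qed.

(** Splitting off [N] factors, the error at [k] is at most half the error at [k - N] plus a term
    from the [N]-th powers, itself at most [e / 2]; strong induction then keeps the same [e] for all
    [k]. *)
Lemma ucv_pow : ucv (fun t k => S t ^+ k) (fun k => T ^+ k).
Proof.
have [N [M [cT cS]]] := near_contr; move=> e e0.
have M0 := contr_ge0 cT.
have e2 : 0 < e / 2 / (M + 1) by rewrite !divr_gt0 // ltr_wpDl.
apply: filterS3 cS (near_ltn N (fun l => ucv_pow_fix l e0)) (ucv_pow_fix N e2).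
move=> t cS h1 h2; elim/ltn_ind => k IHk.
have [kN|Nk] := ltnP k N; first by apply: (h1 k kN 0%N).
have [N0 SN _] := cS.
have {}IHk : nrm (S t ^+ (k - N) - T ^+ (k - N)) <= e.
  by apply: IHk; rewrite ltn_subrL N0 (leq_trans N0).
rewrite -(subnKC Nk) !exprD -!mulmxE; set A := S t ^+ N; set B := T ^+ N.
set A' := S t ^+ _; set B' := T ^+ _.
have -> : A *m A' - B *m B' = A *m (A' - B') + (A - B) *m B'.
  by rewrite mulmxBl mulmxBr addrA subrK.
rewrite (le_trans (nrmD _ _)) // (splitr e) lerD //.
  by rewrite mulrC nrmM_le.
apply: le_trans (nrmM_le (h2 0%N) (contr_pow cT _)) _.
rewrite mulrAC ler_pdivrMr ?ltr_wpDl // ler_wpM2l ?lerDl //.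
by rewrite divr_ge0 ?(ltW e0).
Qed.

(** No a priori bound on [D] is required, since [stein_nrm] applies with the constants that
    [near_contr] provides for all nearby [S t]. *)
Lemma ucv_stein (D : I -> nat -> 'M[C]_n) :
  ucv (fun t k => D t k - S t *m D t k *m (S t)^t*) (fun=> 0) -> ucv D (fun=> 0).
Proof.
have [N [M [cT cS]]] := near_contr; move=> h e e0.
pose K := 2 * N%:R * M ^+ 2 + 1.
have K0 : 0 < K by rewrite ltr_wpDl // mulr_ge0 ?sqr_ge0 // mulr_ge0.
have d0 : 0 < e / K by rewrite divr_gt0.
apply: filterS2 cS (h _ d0) => t {}cS {}h k; rewrite subr0.
rewrite (le_trans (stein_nrm cS _)) //; have := h k; rewrite subr0 => {}h.
apply: (@le_trans _ _ (K * (e / K))); last by rewrite mulrC divfK ?lt0r_neq0.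
by rewrite ler_pM ?lerDl // mulr_ge0 ?sqr_ge0 // mulr_ge0.
Qed.

Lemma near_stein_upper (D E : I -> 'M[C]_n) :
  ucv (fun t _ => E t) (fun=> 0) ->
  (\forall t \near F, forall v, qf (D t - S t *m D t *m (S t)^t*) v <= qf (E t) v) ->
  forall e : R, 0 < e -> \forall t \near F, forall v, qf (D t) v <= e * sq v.
Proof.
have [N [M [cT cS]]] := near_contr; move=> h hD e e0.
pose K := 2 * N%:R * M ^+ 2 + 1.
have K0 : 0 < K by rewrite ltr_wpDl // mulr_ge0 ?sqr_ge0 // mulr_ge0.
have d0 : 0 < e / K by rewrite divr_gt0.
apply: filterS3 cS (h _ d0) hD => t {}cS {}h {}hD v.
have := h 0%N; rewrite subr0 => {}h.
apply: (le_trans (stein_upper cS (ltW d0) _ v)) => [u|].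
  by rewrite (le_trans (hD u)) // (le_trans (qf_le _ _)) // ler_wpM2r ?sq_ge0.
rewrite ler_wpM2r ?sq_ge0 // mulrA ler_pdivrMr // mulrC ler_wpM2l ?(ltW e0) //.
by rewrite lerDl.
Qed.

End Stable.
End UniformLimits.

(** Once every product is generalized to an opaque matrix, the remaining identity is linear and can
    be checked entrywise by [ring]; [mx_ringi] also uses that the square of ['i] is -1. *)
Ltac mx_atoms := repeat match goal with
  |- context [@mulmx ?R ?m ?n ?p ?A ?B] => move: (@mulmx R m n p A B) => ? end.
Ltac mx_ring := mx_atoms; apply/matrixP=> ? ?; rewrite !mxE; ring.
Ltac mx_ringi C := mx_atoms; apply/matrixP=> ? ?; rewrite !mxE; ring: (@sqrCi C).

(** * Controllability and the Cayley transform *)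

Section Controllability.
Variable F : fieldType.

(* Observability of [A, C] is controllability of the adjoints. *)
Definition controllable n m (A : 'M[F]_n) (B : 'M[F]_(n, m)) : Prop :=
  forall p (V : 'M[F]_(p, n)), (V *m A <= V)%MS -> V *m B = 0 -> V = 0.

End Controllability.

Section Cayley.
Variable C : numClosedFieldType.

Definition cay n (a : 'M[C]_n) := invmx (a + 'i%:M) *m (a - 'i%:M).

Lemma cay_comm n (a : 'M[C]_n) : a + 'i%:M \in unitmx ->
  cay a = (a - 'i%:M) *m invmx (a + 'i%:M).
Proof.
move=> u; apply: (can_inj (mulKmx u)); rewrite /cay mulKVmx // mulmxA.
apply: (can_inj (mulmxK u)); rewrite mulmxKV //.
rewrite !(mulmxDl, mulmxDr, mulmxN, mulNmx, mul_scalar_mx, mul_mx_scalar).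
mx_ring.
Qed.

Lemma negctr_unit n (a : 'M[C]_n) :
  (- a^t* + 'i%:M \in unitmx) = (a + 'i%:M \in unitmx).
Proof.
have -> : - a^t* + 'i%:M = (-1) *: (a + 'i%:M)^t*.
  by rewrite ctrD ctr_scalar conjCi raddfN scaleN1r opprD opprK.
by rewrite unitmxZ ?unitmx_ctr // unitrN1.
Qed.

(** Both factors of the transform change sign under [a -> - a^t*], and they commute. This carries
    stability over from the dual system. *)
Lemma cay_negctr n (a : 'M[C]_n) : a + 'i%:M \in unitmx ->
  cay (- a^t*) = (cay a)^t*.
Proof.
move=> u; have u' : - a^t* + 'i%:M \in unitmx by rewrite negctr_unit.
have e1 : - a^t* + 'i%:M = - (a + 'i%:M)^t*.
  by rewrite ctrD ctr_scalar conjCi raddfN opprD opprK.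
have e2 : - a^t* - 'i%:M = - (a - 'i%:M)^t*.
  by rewrite ctrD ctrN ctr_scalar conjCi raddfN opprD opprK.
rewrite (cay_comm u) ctrM ctr_inv /cay e2.
have -> : invmx (- a^t* + 'i%:M) = - invmx ((a + 'i%:M)^t*).
  apply: (can_inj (mulKmx u')); rewrite mulmxV // e1 mulNmx mulmxN opprK mulmxV //.
  by rewrite unitmx_ctr.
by rewrite mulNmx mulmxN opprK.
Qed.

Lemma cay_stein n (a D E : 'M[C]_n) (J := invmx (a + 'i%:M)) :
  a + 'i%:M \in unitmx -> a *m D - D *m a^t* = 'i *: E ->
  D - cay a *m D *m (cay a)^t* = 2%:R *: (J *m E *m J^t*).
Proof.
move=> u aD; have DE : D = J *m ((a + 'i%:M) *m D *m (a + 'i%:M)^t*) *m J^t*.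
  by rewrite !mulmxA mulVmx // mul1mx -mulmxA -ctrM mulVmx // ctr1 mulmx1.
have -> : cay a *m D *m (cay a)^t* =
    J *m ((a - 'i%:M) *m D *m (a - 'i%:M)^t*) *m J^t* by rewrite ctrM !mulmxA.
rewrite {1}DE -mulmxBl -mulmxBr scalemxAl scalemxAr.
congr (_ *m _ *m _); rewrite !(ctrD, ctrN, ctr_scalar) conjCi.
have -> : 2%:R *: E = - (2%:R * 'i) *: (a *m D - D *m a^t*).
  by rewrite aD scalerA mulNr -mulrA -expr2 sqrCi mulrN1 opprK.
rewrite !(mulmxDl, mulmxDr, mulmxN, mulNmx, mul_scalar_mx, mul_mx_scalar).
rewrite -?scalemxAr -?scalemxAl.
mx_ringi C.
Qed.

(** The span [V] of the rows [v T^k] is stable under [T], hence under [J], which is affine in [T].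
    As [J] is invertible, [V J = V], so [V] is also stable under [a = J^-1 - i] and annihilates [L];
    controllability forces [V = 0]. *)
Lemma krylov_ctrl n m (a : 'M[C]_n) (L : 'M[C]_(n, m)) (v : 'rV[C]_n) :
  a + 'i%:M \in unitmx -> controllable a L ->
  (forall k, v *m cay a ^+ k *m (invmx (a + 'i%:M) *m L) = 0) -> v = 0.
Proof.
set J := invmx _; set T := cay a => u aL vL.
pose V : 'M[C]_n := \matrix_(k < n) (v *m T ^+ k).
have vV k : (v *m T ^+ k <= V)%MS.
  have [c ->] := mxpow_span T k; rewrite mulmx_sumr summx_sub // => l _.
  by rewrite -scalemxAr scalemx_sub // (submx_trans _ (row_sub l V)) // rowK.
have VT : (V *m T <= V)%MS.
  by apply/row_subP => k; rewrite row_mul rowK -mulmxA mulmxE -exprSr.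
have JE : J = (2%:R * 'i)^-1 *: (1%:M - T).
  have -> : 1%:M - T = (2%:R * 'i) *: J.
    rewrite -(mulVmx u) -/J /T /cay -/J -mulmxBr -mul_mx_scalar; congr (_ *m _).
    apply/matrixP=> i j; rewrite !mxE mulrnAl; ring.
  by rewrite scalerA mulVf ?scale1r // mulf_neq0 ?neq0Ci // pnatr_eq0.
have VJ : (V *m J <= V)%MS.
  by rewrite JE -scalemxAr scalemx_sub // mulmxBr mulmx1 addmx_sub // eqmx_opp.
have VJ' : (V <= V *m J)%MS.
  by rewrite -(mxrank_leqif_sup VJ).2 mxrankMfree // row_free_unit unitmx_inv.
have V0 : V = 0.
  apply: aL.
    have -> : V *m a = V *m (a + 'i%:M) - 'i *: V.
      by rewrite mulmxDr mul_mx_scalar addrK.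
    rewrite addmx_sub ?eqmx_opp ?scalemx_sub //.
    by rewrite (submx_trans (submxMr _ VJ')) // -mulmxA mulVmx // mulmx1.
  have [Z ->] := submxP VJ'; rewrite -!mulmxA (_ : V *m _ = 0) ?mulmx0 //.
  by apply/row_matrixP => k; rewrite row0 row_mul rowK vL.
by apply/eqP; rewrite -submx0 -V0 -(mulmx1 v); apply: vV 0%N.
Qed.

End Cayley.

(** * The Riccati equation, its dual, and the recovered [alpha] *)

Section System.
Variables (R : realType).
Local Notation C := R[i].

Definition riccati_system n m1 m2 (A : 'M[C]_n) (B : 'M[C]_(n, m2)) (Cc : 'M[C]_(m1, n))
    (X : 'M[C]_n) : Prop :=
  [/\ pd X,
      X *m Cc^t* *m Cc *m X - 'i *: (A *m X - X *m A^t*) - B *m B^t* = 0,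
      controllable A B & controllable (A^t*) (Cc^t*)].

(** Multiplying the Riccati equation by [invmx X] on both sides and changing sign gives the dual
    equation; controllability and observability trade places. *)
Lemma sys_dual n m1 m2 (A : 'M[C]_n) (B : 'M[C]_(n, m2)) (Cc : 'M[C]_(m1, n)) X :
  riccati_system A B Cc X -> riccati_system (A^t*) (Cc^t*) (B^t*) (invmx X).
Proof.
move=> [Xpd ric AB AC]; have Xu := pd_unit Xpd; have [Xh Xp] := Xpd.
split=> //; rewrite ?trmxCK //.
  split=> [|v v0]; first by rewrite ctr_inv Xh.
  have -> : qf (invmx X) v = qf X (v *m invmx X).
    by rewrite -qf_congr mulVmx // mul1mx ctr_inv Xh.
  apply: Xp; apply: contra v0 => /eqP vX.
  by rewrite -(mulmxKV Xu v) vX mul0mx.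
have := congr1 (fun M => - (invmx X *m M *m invmx X)) ric.
rewrite mulmx0 mul0mx oppr0 => <-.
have e1 : invmx X *m (X *m Cc^t* *m Cc *m X) *m invmx X = Cc^t* *m Cc.
  by rewrite !mulmxA mulVmx // mul1mx mulmxK.
have e2 : invmx X *m (A *m X) *m invmx X = invmx X *m A by rewrite mulmxA mulmxK.
have e3 : invmx X *m (X *m A^t*) *m invmx X = A^t* *m invmx X.
  by rewrite mulmxA mulVmx // mul1mx.
rewrite !(mulmxBr, mulmxBl) -scalemxAr -scalemxAl !(mulmxBr, mulmxBl) e1 e2 e3.
by rewrite !mulmxA; mx_ring.
Qed.

Section One.
Variables (n m1 m2 : nat) (A : 'M[C]_n) (B : 'M[C]_(n, m2)) (Cc : 'M[C]_(m1, n)).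
Variable X : 'M[C]_n.
Hypothesis sysX : riccati_system A B Cc X.

Let alpha := recovered_alpha A B X.
Let th1 : 'M[C]_(n, m1) := X *m Cc^t*.
Let L0 := row_mx th1 ('i *: B).

(** The Riccati equation eliminates [B]: through [X], [alpha] is similar to a feedback modification
    of [- A^t*], so observability of the realization becomes usable. *)
Lemma alphaX : alpha *m X = - (X *m A^t*) + 'i *: (X *m Cc^t* *m Cc *m X).
Proof.
have [Xpd ric _ _] := sysX; have Xu := pd_unit Xpd.
have -> : alpha *m X = - (A *m X) + 'i *: (B *m B^t*).
  by rewrite mulmxDl mulNmx -scalemxAl mulmxKV.
move: ric => /(congr1 (fun M => 'i *: M)); rewrite scaler0.
mx_atoms => ric; apply/eqP; rewrite -subr_eq0 -oppr_eq0 -[X in _ == X]ric; apply/eqP.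
mx_ringi constr:(C).
Qed.

Lemma ctrl_alpha : controllable alpha th1.
Proof.
have [Xpd ric _ AC] := sysX; have Xu := pd_unit Xpd.
move=> p V Va; rewrite mulmxA => Vth; rewrite -(mulmxK Xu V).
rewrite (AC p (V *m X)) ?mul0mx //.
have -> : V *m X *m A^t* = - (V *m alpha *m X).
  rewrite -(mulmxA V alpha) alphaX mulmxDr mulmxN -scalemxAr !mulmxA.
  by rewrite Vth !mul0mx scaler0 addr0 opprK.
by rewrite eqmx_opp submxMr.
Qed.

Lemma alpha_lyap : alpha *m X - X *m alpha^t* = 'i *: (L0 *m L0^t*).
Proof.
have [[Xh Xp] ric _ _] := sysX.
have -> : L0 *m L0^t* = X *m Cc^t* *m Cc *m X + B *m B^t*.
  rewrite /L0 /th1 ctr_row_mx mul_row_col ctrM trmxCK Xh ctrZ conjCi.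
  rewrite -scalemxAl -scalemxAr !scalerA mulrN -expr2 sqrCi opprK scale1r.
  by rewrite !mulmxA.
have -> : X *m alpha^t* = (alpha *m X)^t* by rewrite ctrM Xh.
rewrite alphaX ctrD ctrN ctrZ !ctrM !trmxCK Xh conjCi !mulmxA.
move: ric => /(congr1 (fun M => 'i *: M)); rewrite scaler0.
mx_atoms => ric; apply/eqP; rewrite -subr_eq0 -[X in _ == X]ric; apply/eqP.
mx_ringi constr:(C).
Qed.

End One.
End System.

Section SystemStability.
Variables (R : realType).
Local Notation C := R[i].
Variables (n m1 m2 : nat) (A : 'M[C]_n) (B : 'M[C]_(n, m2)) (Cc : 'M[C]_(m1, n)).
Variable X : 'M[C]_n.
Hypothesis sysX : riccati_system A B Cc X.

Let alpha := recovered_alpha A B X.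
Let L0 := row_mx (X *m Cc^t*) ('i *: B).

(** On a left eigenvector [v] for [- s * 'i], [alpha_lyap] reads
    [sq (v *m L0) = - 2 * s * qf X v <= 0]. So [v] annihilates the first block of [L0], which
    [ctrl_alpha] excludes unless [v = 0]. The cases used are [s = 0] and [s = 1]. *)
Lemma alpha_shift_unit (s : R) : 0 <= s -> alpha + (s%:C%C * 'i)%:M \in unitmx.
Proof.
move=> s0; apply: unitmx_inj => v; rewrite mulmxDr mul_mx_scalar => /eqP.
rewrite addr_eq0 -scaleNr => /eqP va; have [Xpd _ _ _] := sysX.
have [Xh Xp] := Xpd.
have qX := pd_ge0 v Xpd.
have vL : v *m L0 = 0.
  apply: sq_eq0; rewrite -qf_gram.
  have sC : (s%:C%C : C)^* = s%:C%C by apply: conjc_real.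
  have e1 : v *m (alpha *m X) *m v^t* = - (s%:C%C * 'i) *: (v *m X *m v^t*).
    by rewrite mulmxA va -!scalemxAl.
  have e2 : v *m (X *m alpha^t*) *m v^t* = (s%:C%C * 'i) *: (v *m X *m v^t*).
    rewrite -!mulmxA -ctrM va ctrZ rmorphN rmorphM /= conjCi mulrN opprK sC.
    by rewrite -!scalemxAr.
  have := congr1 (fun M => (v *m M *m v^t*) 0 0) (alpha_lyap sysX).
  rewrite /= -/alpha -/L0 mulmxBr mulmxBl e1 e2 -scalemxAr -scalemxAl.
  rewrite mxE [X in X + _]mxE [X in _ + X]mxE [X in _ - X]mxE [RHS]mxE.
  rewrite (qf_herm v Xh) qf_herm ?ctrM ?trmxCK // => h.
  have {h} : (qf (L0 *m L0^t*) v)%:C%C = (- 2 * s * qf X v)%:C%C.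
    apply: (mulfI (neq0Ci C)); rewrite -h.
    by rewrite !rmorphM rmorphN /= rmorphMn /= rmorph1; ring.
  by move/complexI => ->; have := mulr_ge0 s0 qX; lra.
have := vL; rewrite mul_mx_row => /eqP; rewrite row_mx_eq0 => /andP[/eqP vth _].
apply: (ctrl_alpha sysX) vth; rewrite -/alpha va scalemx_sub //.
Qed.

Lemma alpha_unit : alpha \in unitmx.
Proof.
by have := alpha_shift_unit (lexx 0); rewrite mul0r raddf0 addr0.
Qed.

Lemma alphai_unit : alpha + 'i%:M \in unitmx.
Proof. by have := alpha_shift_unit ler01; rewrite mul1r. Qed.

Lemma pstab_cay : pstab (cay alpha).
Proof.
have [Xpd _ _ _] := sysX; have u := alphai_unit.
(* Scaling by the square root of 2 absorbs the factor 2 of [cay_stein] into the Gram factor. *)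
pose r := ((Num.sqrt (2 : R))%:C)%C : C.
have rr : r * r^* = 2%:R.
  rewrite /r (_ : _^* = r); last exact: conjc_real.
  by rewrite -rmorphM -expr2 sqr_sqrtr // rmorphMn rmorph1.
apply: (@pstab_gram R n _ (cay alpha) X (r *: (invmx (alpha + 'i%:M) *m L0)) Xpd).
  rewrite (cay_stein u (alpha_lyap sysX)) -/L0 ctrZ ctrM.
  by rewrite -scalemxAl -scalemxAr scalerA rr !mulmxA.
move=> v vG; apply: (krylov_ctrl u (ctrl_alpha sysX)) => k.
have := vG k; rewrite -scalemxAr => /eqP; rewrite scaler_eq0.
have -> /= : (r == 0) = false.
  by apply/negP => /eqP r0; move/eqP: rr; rewrite r0 mul0r eq_sym pnatr_eq0.
rewrite mulmxA !mul_mx_row row_mx_eq0 => /andP[/eqP h _].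
by rewrite -/alpha mulmxA.
Qed.

End SystemStability.

(** * The normalized sequences [L_k] and [R_k] *)

Section Sequences.
Variables (R : realType).
Local Notation C := R[i].
Variables (n m1 m2 : nat) (alpha : 'M[C]_n).
Variables (th1 : 'M[C]_(n, m1)) (th2 : 'M[C]_(n, m2)) (S0 : 'M[C]_n).
Let L0 := row_mx th1 th2.
Hypotheses (au : alpha \in unitmx) (aiu : alpha + 'i%:M \in unitmx).
Hypothesis lyap : alpha *m S0 - S0 *m alpha^t* = 'i *: (L0 *m L0^t*).

Local Notation Lam := (Lambda_seq alpha L0).
Local Notation S := (S_seq alpha L0 S0).
Local Notation j := (jmx R m1 m2).

Lemma jmx_sq : j *m j = 1%:M.
Proof.
rewrite mulmx_block !(mulmx0, mul0mx, mul1mx, mulmxN, mulNmx, addr0, add0r, mulmx1).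
by rewrite opprK -scalar_mx_block.
Qed.

Lemma jmx_ctr : j^t* = j.
Proof.
by rewrite tr_block_mx map_block_mx linearN /= map_mxN !trmx0 !map_mx0 !tr_scalar_mx
   !map_scalar_mx rmorph1.
Qed.

(** In the step, [j *m j = 1%:M] reduces the right-hand side to the identity at [k], its conjugate
    by [invmx alpha], and cross terms that match those produced by the last summand of [S]. *)
Lemma S_lyap k : alpha *m S k - S k *m alpha^t* = 'i *: (Lam k *m (Lam k)^t*).
Proof.
elim: k => [//|k /=]; move: (S k) (Lam k) => s L IH.
have au' : alpha^t* \in unitmx by rewrite unitmx_ctr.
set b := invmx alpha; set c := invmx (alpha^t*).
have bc : b^t* = c by rewrite ctr_inv.
have IH2 : s *m c - b *m s = 'i *: (b *m L *m L^t* *m c).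
  have := congr1 (fun M => b *m M *m c) IH.
  rewrite mulmxBr mulmxBl -scalemxAr -scalemxAl !mulmxA mulVmx // mul1mx => <-.
  by rewrite mulmxK.
have jj (M : 'M[C]_(n, m1 + m2)) : M *m j *m j = M by rewrite -mulmxA jmx_sq mulmx1.
rewrite ctrD ctrZ !ctrM jmx_ctr bc conjCi.
rewrite !(mulmxDr, mulmxDl) -!scalemxAr -!scalemxAl.
have bK p (M : 'M[C]_(n, p)) : alpha *m (b *m M) = M by rewrite mulKVmx.
have cK p (M : 'M[C]_(p, n)) : M *m c *m alpha^t* = M by rewrite mulmxKV.
have e1 : alpha *m (b *m s *m c) = s *m c by rewrite -mulmxA bK.
have e2 : alpha *m (b *m L *m j *m L^t* *m c) = L *m j *m L^t* *m c.
  by rewrite -!mulmxA bK.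
rewrite e1 e2 !cK !mulmxA !jj.
move: IH IH2; mx_atoms => IH IH2.
rewrite (canRL (subrK _) IH) (canRL (subrK _) IH2); mx_ringi constr:(C).
Qed.

Let T := cay alpha.
Let J := invmx (alpha + 'i%:M).
Let P : 'M[C]_n := 1%:M + 'i *: invmx alpha.

Definition Lseq k := row_mx th1 (T ^+ k *m th2).
Definition Rseq k := invmx (P ^+ k) *m S k *m (invmx (P ^+ k))^t*.

Lemma P_eq : P = invmx alpha *m (alpha + 'i%:M).
Proof. by rewrite mulmxDr mulVmx // mul_mx_scalar. Qed.

Lemma P_eq' : P = (alpha + 'i%:M) *m invmx alpha.
Proof. by rewrite mulmxDl mulmxV // mul_scalar_mx. Qed.

Lemma P_unit : P \in unitmx.
Proof. by rewrite P_eq unitmx_mul unitmx_inv au. Qed.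

Lemma PX_unit k : P ^+ k \in unitmx.
Proof.
elim: k => [|k IHk]; first by rewrite expr0 unitmx1.
by rewrite exprS -mulmxE unitmx_mul P_unit.
Qed.

Lemma P_alpha : P *m alpha = alpha *m P.
Proof.
by rewrite mulmxDl mulmxDr -scalemxAl -scalemxAr mulVmx // mulmxV // mul1mx mulmx1.
Qed.

Lemma PT : P *m T = 1%:M - 'i *: invmx alpha.
Proof.
rewrite P_eq /T /cay -!mulmxA mulKVmx // mulmxBr mulVmx //.
by rewrite mul_mx_scalar.
Qed.

Lemma TP : T *m P = P *m T.
Proof.
rewrite PT P_eq' /T cay_comm // -mulmxA mulKmx // mulmxBl mulmxV //.
by rewrite mul_scalar_mx.
Qed.

Lemma mul_row_jmx p (a : 'M[C]_(p, m1)) (b : 'M[C]_(p, m2)) :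
  row_mx a b *m j = row_mx a (- b).
Proof.
by rewrite mul_row_block !mulmx1 !mulmx0 addr0 add0r mulmxN mulmx1.
Qed.

(** Because of the signs in [j], one step multiplies the first block by [P] and the second by
    [1 - i alpha^-1], which is [P *m T]; and [P] commutes with [T]. *)
Lemma Lam_eq k : Lam k = P ^+ k *m Lseq k.
Proof.
rewrite /Lseq mul_mx_row mulmxA mulmxE -(exprMn_comm _ (esym TP : GRing.comm P T)).
rewrite -!mulmxE -/(P *m T) PT.
elim: k => [|k IHk]; first by rewrite !expr0 !mul1mx.
rewrite /= IHk -!mulmxA mul_row_jmx mul_mx_row scale_row_mx add_row_mx.
congr row_mx; rewrite exprS -mulmxE -mulmxA mulmxDl mul1mx ?mulNmx -scalemxAl //.
by rewrite mulmxN scalerN.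
Qed.

(** The identity for [S k] survives removal of [P ^+ k], which commutes with [alpha]. *)
Lemma R_lyap k : alpha *m Rseq k - Rseq k *m alpha^t* = 'i *: (Lseq k *m (Lseq k)^t*).
Proof.
have u := PX_unit k; set W := invmx (P ^+ k).
have Wa : W *m alpha = alpha *m W.
  apply: (can_inj (mulKmx u)); rewrite mulKVmx //.
  have Pa : P ^+ k *m alpha = alpha *m P ^+ k.
    by rewrite !mulmxE; apply/esym/commrX; rewrite /GRing.comm -mulmxE P_alpha.
  by rewrite mulmxA Pa -mulmxA mulmxV // mulmx1.
have -> : Lseq k = W *m Lam k by rewrite Lam_eq mulKmx.
have aW : W^t* *m alpha^t* = alpha^t* *m W^t* by rewrite -!ctrM Wa.
have e1 : alpha *m Rseq k = W *m (alpha *m S k) *m W^t*.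
  by rewrite /Rseq -/W !mulmxA Wa.
have e2 : Rseq k *m alpha^t* = W *m (S k *m alpha^t*) *m W^t*.
  by rewrite /Rseq -/W -!mulmxA aW.
rewrite e1 e2 -mulmxBl -mulmxBr S_lyap -scalemxAr -scalemxAl.
by rewrite ctrM !mulmxA.
Qed.

Lemma R_stein k :
  Rseq k - T *m Rseq k *m T^t* = 2%:R *: (J *m (Lseq k *m (Lseq k)^t*) *m J^t*).
Proof. exact/cay_stein/R_lyap. Qed.

Lemma LamSLam k : Rseq k \in unitmx ->
  (Lam k)^t* *m invmx (S k) *m Lam k = (Lseq k)^t* *m invmx (Rseq k) *m Lseq k.
Proof.
have u := PX_unit k => Ru.
have SE : S k = P ^+ k *m Rseq k *m (P ^+ k)^t*.
  by rewrite /Rseq ctr_inv !mulmxA mulmxV // mul1mx mulmxKV // unitmx_ctr.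
have u' : (P ^+ k)^t* \in unitmx by rewrite unitmx_ctr.
move: (Rseq k) Ru SE => r ru SE.
have -> : invmx (S k) = (invmx (P ^+ k))^t* *m invmx r *m invmx (P ^+ k).
  have Su : S k \in unitmx by rewrite SE !unitmx_mul u u' ru.
  apply: (can_inj (mulKmx Su)); rewrite mulmxV // {1}SE !mulmxA ctr_inv.
  by rewrite mulmxK // mulmxK // mulmxV.
by rewrite Lam_eq ctrM !mulmxA ctr_inv mulmxK // mulmxKV.
Qed.

(** Iterating the Stein identity [n.+1] times, the remainder is nonnegative and may be dropped, as
    may the second block of [Lseq k], the only one depending on [k]. *)
Lemma R_ge_gramian k v : pstab T ->
  2 * qf (gramian T (J *m th1)) v <= qf (Rseq k) v.
Proof.
move=> /pstab_contr [N [M [cT _]]].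
have Fq w : qf (Rseq k - T *m Rseq k *m T^t*) w = 2 * sq (w *m (J *m Lseq k)).
  have two : 2%:R = (2 : R)%:C%C :> C by rewrite rmorphMn rmorph1.
  rewrite R_stein two.
  by rewrite qfZ -qf_gram ctrM !mulmxA.
(* Nonnegativity comes from [stein_upper] for [- Rseq k] with constant 0. *)
have R0 w : 0 <= qf (Rseq k) w.
  rewrite -oppr_le0 -qfN; have := stein_upper cT (D := - Rseq k) (lexx 0).
  rewrite mulr0 => h; rewrite (le_trans (h _ w)) ?mul0r // => u.
  rewrite mul0r mulmxN mulNmx -opprD qfN Fq.
  by rewrite oppr_le0 mulr_ge0 ?sq_ge0.
rewrite (stein_iter T (Rseq k) n.+1) qfD qf_congr ler_wpDl ?R0 //.
rewrite /gramian !qf_sum mulr_sumr; apply: ler_sum => l _.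
rewrite !qf_congr Fq qf_gram ler_wpM2l // /Lseq !mul_mx_row.
by rewrite sq_row_mx lerDl sq_ge0.
Qed.

End Sequences.

(** * Continuity of the positive Riccati solution *)

Section Continuity.
Variables (R : realType) (I : Type) (F : set_system I).
Context {FF : Filter F}.
Local Notation C := R[i].

Lemma ucv_cay n (a : I -> 'M[C]_n) (b : 'M[C]_n) : b + 'i%:M \in unitmx ->
  ucv F (fun t _ => a t) (fun=> b) ->
  [/\ \forall t \near F, a t + 'i%:M \in unitmx,
      ucv F (fun t _ => invmx (a t + 'i%:M)) (fun=> invmx (b + 'i%:M)) &
      ucv F (fun t _ => cay (a t)) (fun=> cay b)].
Proof.
move=> u h; have hi : ucv F (fun t _ => a t + 'i%:M) (fun=> b + 'i%:M).
  exact: ucvD h (ucv_cst (fun=> 'i%:M)).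
have [nu hJ] := ucv_inv (g := fun=> b + 'i%:M) (bnd_cst _) (fun=> u) hi.
split=> //; first by apply: filterS nu => t /(_ 0%N).
apply: ucvM => //; try exact: bnd_cst.
exact: ucvB h (ucv_cst (fun=> 'i%:M)).
Qed.

Lemma qf_congr_subgram n p (J E : 'M[C]_n) (Z : 'M[C]_(n, p)) v :
  qf (2%:R *: (J *m (E - Z *m Z^t*) *m J^t*)) v <= qf (2%:R *: (J *m E *m J^t*)) v.
Proof.
have two : 2%:R = (2 : R)%:C%C :> C by rewrite rmorphMn rmorph1.
by rewrite two !qfZ ler_wpM2l // !qf_congr qfB gerBl qf_gram sq_ge0.
Qed.

Section SolutionUpper.
Variables (n m1 m2 : nat) (A : 'M[C]_n) (B : 'M[C]_(n, m2)) (Cc : 'M[C]_(m1, n)).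
Variable X : 'M[C]_n.
Variables (At : I -> 'M[C]_n) (Bt : I -> 'M[C]_(n, m2)) (Ct : I -> 'M[C]_(m1, n)).
Variable Xt : I -> 'M[C]_n.
Hypotheses (sysX : riccati_system A B Cc X)
  (sysXt : \forall t \near F, riccati_system (At t) (Bt t) (Ct t) (Xt t)).
Hypotheses (cvA : ucv F (fun t _ => At t) (fun=> A))
  (cvB : ucv F (fun t _ => Bt t) (fun=> B)) (cvC : ucv F (fun t _ => Ct t) (fun=> Cc)).

Lemma solution_upper (e : R) : 0 < e ->
  \forall t \near F, forall v, qf (Xt t - X) v <= e * sq v.
Proof.
have [Xpd ric _ _] := sysX; have [Xh Xp] := Xpd.
pose K := X *m Cc^t*; pose a A' Cc' : 'M[C]_n := A' + 'i *: (K *m Cc').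
have Kh : K^t* = Cc *m X by rewrite ctrM trmxCK Xh.
pose a' := recovered_alpha (A^t*) (Cc^t*) (invmx X).
(* The matrix with the gain [K] frozen at the unperturbed solution is, up to sign and adjoint, the
   recovered [alpha] of the dual system, whence its stability. *)
have aa' : a A Cc = - a'^t*.
  rewrite /a' /recovered_alpha invmxK ctrD ctrN ctrZ !ctrM !trmxCK Xh conjCi.
  by rewrite scaleNr opprD !opprK !mulmxA.
have u' : a' + 'i%:M \in unitmx := alphai_unit (sys_dual sysX).
have u : a A Cc + 'i%:M \in unitmx by rewrite aa' negctr_unit.
have stab : pstab (cay (a A Cc)).
  rewrite aa' (cay_negctr u'); exact: pstab_ctr (pstab_cay (sys_dual sysX)).
have cva : ucv F (fun t _ => a (At t) (Ct t)) (fun=> a A Cc).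
  exact: ucvD cvA (ucvZ 'i (ucvM (bnd_cst K) (bnd_cst Cc) (ucv_cst (fun=> K)) cvC)).
have [nu cvJ cvT] := ucv_cay u cva.
(* [E] collects the terms free of [Xt]; at the unperturbed data it is minus the left-hand side of
   the Riccati equation, hence 0. *)
pose E A' (B' : 'M[C]_(n, m2)) Cc' : 'M[C]_n := K *m K^t* + B' *m B'^t*
   + 'i *: (a A' Cc' *m X - X *m (a A' Cc')^t*).
have E0 : E A B Cc = 0.
  rewrite /E /a Kh ctrD ctrZ ctrM Kh conjCi mulmxDl mulmxDr -!scalemxAr -!scalemxAl.
  rewrite /K !mulmxA; move: ric; mx_atoms => ric.
  by rewrite -[RHS]oppr0 -ric; mx_ringi constr:(C).
have cvE : ucv F (fun t _ => E (At t) (Bt t) (Ct t)) (fun=> E A B Cc).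
  exact: ucvD (ucvD (ucv_cst (fun=> K *m K^t*))
    (ucvM (bnd_cst _) (bnd_cst _) cvB (ucv_ctr cvB)))
    (ucvZ 'i (ucvB (ucvM (bnd_cst _) (bnd_cst _) cva (ucv_cst (fun=> X)))
                   (ucvM (bnd_cst _) (bnd_cst _) (ucv_cst (fun=> X)) (ucv_ctr cva)))).
pose J t := invmx (a (At t) (Ct t) + 'i%:M).
apply: (near_stein_upper stab cvT (E := fun t =>
  2%:R *: (J t *m E (At t) (Bt t) (Ct t) *m (J t)^t*))).
  apply: (@ucv_eq_lim _ _ _ _ _ _ _ (fun=> 2%:R *: (invmx (a A Cc + 'i%:M) *m E A B Cc
      *m (invmx (a A Cc + 'i%:M))^t*))) => [_|].
    by rewrite E0 mulmx0 mul0mx scaler0.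
  apply: ucvZ; apply: ucvM (ucv_ctr cvJ); try exact: bnd_cst.
  apply: ucvM cvJ cvE; exact: bnd_cst.
apply: filterS2 sysXt nu => t [[Xth _] rict _ _] ut v.
pose Z := Xt t *m (Ct t)^t* - K.
(* Completing the square in the perturbed Riccati equation. *)
have DE : a (At t) (Ct t) *m (Xt t - X) - (Xt t - X) *m (a (At t) (Ct t))^t*
    = 'i *: (E (At t) (Bt t) (Ct t) - Z *m Z^t*).
  rewrite /E /Z /a; clearbody K.
  rewrite !(ctrD, ctrN, ctrZ, ctrM) trmxCK Xth conjCi.
  rewrite !(mulmxDl, mulmxDr, mulmxN, mulNmx) -?scalemxAr -?scalemxAl.
  rewrite !mulmxA; move: rict; mx_atoms => rict.
  apply/eqP; rewrite -subr_eq0; apply/eqP.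
  rewrite -[RHS](scaler0 _ 'i) -rict; mx_ringi constr:(C).
rewrite (cay_stein ut DE); exact: qf_congr_subgram.
Qed.

End SolutionUpper.

Section SolutionLimit.
Variables (n m1 m2 : nat) (A : 'M[C]_n) (B : 'M[C]_(n, m2)) (Cc : 'M[C]_(m1, n)).
Variable X : 'M[C]_n.
Variables (At : I -> 'M[C]_n) (Bt : I -> 'M[C]_(n, m2)) (Ct : I -> 'M[C]_(m1, n)).
Variable Xt : I -> 'M[C]_n.
Hypotheses (sysX : riccati_system A B Cc X)
  (sysXt : \forall t \near F, riccati_system (At t) (Bt t) (Ct t) (Xt t)).
Hypotheses (cvA : ucv F (fun t _ => At t) (fun=> A))
  (cvB : ucv F (fun t _ => Bt t) (fun=> B)) (cvC : ucv F (fun t _ => Ct t) (fun=> Cc)).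

Lemma solution_cv : ucv F (fun t _ => Xt t) (fun=> X).
Proof.
move=> e e0; have [Xpd _ _ _] := sysX; have [Xh Xp] := Xpd.
have Xu := pd_unit Xpd.
(* [c] compensates the constant of [nrm_herm_le], and [d] below compensates the congruence by
   [X]. *)
pose c : R := e / (n%:R * n%:R * 5 + 1).
have c0 : 0 < c by rewrite divr_gt0 // ltr_wpDl // !mulr_ge0.
pose d : R := c / (nrm X ^+ 2 + 1).
have X1 : 0 < nrm X ^+ 2 + 1 by rewrite ltr_wpDl // sqr_ge0.
have d0 : 0 < d by rewrite divr_gt0.
have sysXt' : \forall t \near F,
    riccati_system ((At t)^t*) ((Ct t)^t*) ((Bt t)^t*) (invmx (Xt t)).
  by apply: filterS sysXt => t /sys_dual.
have up : \forall t \near F, forall v, qf (Xt t - X) v <= c * sq v.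
  refine (solution_upper sysX sysXt cvA cvB cvC c0).
have low : \forall t \near F, forall v,
    qf (invmx (Xt t) - invmx X) v <= d * sq v.
  refine (solution_upper (sys_dual sysX) sysXt' (ucv_ctr cvA) (ucv_ctr cvC)
    (ucv_ctr cvB) d0).
apply: filterS3 sysXt up low => t sysXt1 {}up {}low _.
have [Xtpd _ _ _] := sysXt1; have [Xth _] := Xtpd; have Xtu := pd_unit Xtpd.
pose D := Xt t - X; have Dh : D^t* = D by rewrite ctrD ctrN Xth Xh.
(* The last term is a nonnegative form, so the upper bound on the difference of inverses becomes a
   lower bound on [D]. *)
have DE : D = X *m (invmx X - invmx (Xt t)) *m X^t* + D *m invmx (Xt t) *m D^t*.
  rewrite Xh Dh /D mulmxBr mulmxBl mulmxV // mul1mx.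
  rewrite !(mulmxBl, mulmxBr) mulmxV // !mul1mx mulmxKV //.
  by mx_ring.
have Dlow v : - (c * sq v) <= qf D v.
  have [Ypd _ _ _] := sys_dual sysXt1.
  have := pd_ge0 (v *m D) Ypd; have := low (v *m X).
  have : qf D v = qf (invmx X - invmx (Xt t)) (v *m X) + qf (invmx (Xt t)) (v *m D).
    by rewrite -(qf_congr X) -(qf_congr D) -qfD -DE.
  rewrite -[invmx X - _]opprB qfN => h0 h1 h2.
  have h3 : d * sq (v *m X) <= c * sq v.
    apply: (@le_trans _ _ (d * (nrm X ^+ 2 * sq v))).
      by rewrite ler_wpM2l ?sq_mul ?(ltW d0).
    rewrite mulrA ler_wpM2r ?sq_ge0 // mulrAC ler_pdivrMr // ler_wpM2l ?(ltW c0) //.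
    by rewrite lerDl.
  by rewrite h0 -[leLHS]addr0 lerD // lerN2 (le_trans h1).
have Dle v : `|qf D v| <= c * sq v by rewrite ler_norml Dlow up.
rewrite (le_trans (nrm_herm_le Dh c0 Dle)) // mulrA /c mulrCA ler_piMr ?(ltW e0) //.
by rewrite ler_pdivrMr ?mul1r ?lerDl // ltr_wpDl // !mulr_ge0.
Qed.

End SolutionLimit.
End Continuity.

(** * Uniform convergence of the recovered potential *)

Section PotentialLimit.
Variable R : realType.
Local Notation C := R[i].

Section OneSystem.
Variables (n m1 m2 : nat) (A : 'M[C]_n) (B : 'M[C]_(n, m2)) (Cc : 'M[C]_(m1, n)).
Variable X : 'M[C]_n.

(* [sysL], [sysR], [sysQ] are the [L_k], [R_k], [Q_k] of the header. *)
Definition sysL k := Lseq (recovered_alpha A B X) (X *m Cc^t*) ('i *: B) k.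
Definition sysR k := Rseq (recovered_alpha A B X) (X *m Cc^t*) ('i *: B) X k.
Definition sysQ k := (sysL k)^t* *m invmx (sysR k) *m sysL k.

Hypothesis sysX : riccati_system A B Cc X.
Let J := invmx (recovered_alpha A B X + 'i%:M).
Let T := cay (recovered_alpha A B X).

Lemma sysR_stein k :
  sysR k - T *m sysR k *m T^t* = 2%:R *: (J *m (sysL k *m (sysL k)^t*) *m J^t*).
Proof. exact: R_stein (alpha_unit sysX) (alphai_unit sysX) (alpha_lyap sysX) k. Qed.

Lemma sysR_lower :
  exists2 c : R, 0 < c & forall k v, c * sq v <= qf (sysR k) v.
Proof.
have [] := @pd_lower _ _ (gramian T (J *m (X *m Cc^t*))).
  by apply: gramian_pd => v; apply: krylov_ctrl (alphai_unit sysX) (ctrl_alpha sysX).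
move=> c c0 cP; exists (2 * c) => [|k v]; first by rewrite mulr_gt0.
apply: le_trans (R_ge_gramian (alpha_unit sysX) (alphai_unit sysX) (alpha_lyap sysX)
  k v (pstab_cay sysX)).
by rewrite -mulrA ler_wpM2l // cP.
Qed.

Lemma sysR_unit k : sysR k \in unitmx.
Proof. by have [c c0 cP] := sysR_lower; apply: lower_unit c0 (cP k). Qed.

Lemma bnd_sysL : bnd sysL.
Proof.
apply: bnd_row_mx; first exact: bnd_cst.
exact: bndM (bnd_pow (pstab_cay sysX)) (bnd_cst _).
Qed.

Lemma bnd_sysR : bnd sysR.
Proof.
have [N [M [cT _]]] := pstab_contr (pstab_cay sysX).
have [b bP] : bnd (fun k => J *m (sysL k *m (sysL k)^t*) *m J^t*).
  apply: bndM (bnd_cst _); apply: bndM (bnd_cst _) _.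
  exact: bndM bnd_sysL (bnd_ctr bnd_sysL).
exists (2 * N%:R * M ^+ 2 * (normc (2%:R : C) * b)) => k.
rewrite (le_trans (stein_nrm cT _)) // ler_wpM2l //.
  by rewrite mulr_ge0 ?sqr_ge0 // mulr_ge0.
by rewrite sysR_stein nrmZ ler_wpM2l ?normc_ge0.
Qed.

Lemma bnd_inv_sysR : bnd (fun k => invmx (sysR k)).
Proof.
have [c c0 cP] := sysR_lower; exists (n%:R * n%:R * c^-1) => k.
exact: nrm_inv_lower c0 (cP k).
Qed.

Lemma recovered_potentialE k :
  recovered_potential A B Cc X k = jmx R m1 m2 + sysQ k - sysQ k.+1.
Proof.
have e := LamSLam (alpha_unit sysX) (alphai_unit sysX) (sysR_unit _).
by rewrite /recovered_potential /= -/(Lambda_seq _ _ k.+1) -/(S_seq _ _ _ k.+1) !e.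
Qed.

End OneSystem.

Lemma steinB n (T D1 D2 : 'M[C]_n) :
  D1 - T *m D1 *m T^t* - (D2 - T *m D2 *m T^t*)
  = D1 - D2 - T *m (D1 - D2) *m T^t*.
Proof. by rewrite mulmxBr mulmxBl; mx_ring. Qed.

Section Limit.
Variables (I : Type) (F : set_system I).
Context {FF : Filter F}.
Variables (n m1 m2 : nat) (A : 'M[C]_n) (B : 'M[C]_(n, m2)) (Cc : 'M[C]_(m1, n)).
Variable X : 'M[C]_n.
Variables (At : I -> 'M[C]_n) (Bt : I -> 'M[C]_(n, m2)) (Ct : I -> 'M[C]_(m1, n)).
Variable Xt : I -> 'M[C]_n.
Hypotheses (sysX : riccati_system A B Cc X)
  (sysXt : \forall t \near F, riccati_system (At t) (Bt t) (Ct t) (Xt t)).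
Hypotheses (cvA : ucv F (fun t _ => At t) (fun=> A))
  (cvB : ucv F (fun t _ => Bt t) (fun=> B)) (cvC : ucv F (fun t _ => Ct t) (fun=> Cc)).

Lemma potential_cv :
  ucv F (fun t k => recovered_potential (At t) (Bt t) (Ct t) (Xt t) k)
    (fun k => recovered_potential A B Cc X k).
Proof.
have cvX : ucv F (fun t _ => Xt t) (fun=> X).
  exact (solution_cv sysX sysXt cvA cvB cvC).
have [Xpd _ _ _] := sysX; have Xu := pd_unit Xpd.
have [_ cvXi] := ucv_inv (g := fun=> X) (bnd_cst _) (fun=> Xu) cvX.
have cva : ucv F (fun t _ => recovered_alpha (At t) (Bt t) (Xt t))
    (fun=> recovered_alpha A B X).
  exact: ucvD (ucvN cvA) (ucvZ 'i (ucvM (bnd_cst _) (bnd_cst _)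
    (ucvM (bnd_cst _) (bnd_cst _) cvB (ucv_ctr cvB)) cvXi)).
have [_ cvJ cvT] := ucv_cay (alphai_unit sysX) cva.
have stab := pstab_cay sysX.
have cvL : ucv F (fun t k => sysL (At t) (Bt t) (Ct t) (Xt t) k) (sysL A B Cc X).
  apply: ucv_row_mx; first exact: ucvM (bnd_cst _) (bnd_cst _) cvX (ucv_ctr cvC).
  exact: ucvM (bnd_pow stab) (bnd_cst _) (ucv_pow stab cvT) (ucvZ 'i cvB).
have bL := bnd_sysL sysX; have bR := bnd_sysR sysX.
pose J t := invmx (recovered_alpha (At t) (Bt t) (Xt t) + 'i%:M).
pose T t := cay (recovered_alpha (At t) (Bt t) (Xt t)).
have cvF : ucv F (fun t k => 2%:R *: (J t *m (sysL (At t) (Bt t) (Ct t) (Xt t) k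
    *m (sysL (At t) (Bt t) (Ct t) (Xt t) k)^t*) *m (J t)^t*))
  (fun k => sysR A B Cc X k - cay (recovered_alpha A B X) *m sysR A B Cc X k
    *m (cay (recovered_alpha A B X))^t*).
  apply: ucv_eq_lim (fun k => esym (sysR_stein sysX k)) _.
  have bLL := bndM bL (bnd_ctr bL).
  apply: ucvZ; apply: ucvM (bndM (bnd_cst _) bLL) (bnd_cst _) _ (ucv_ctr cvJ).
  apply: ucvM (bnd_cst _) bLL cvJ _.
  exact: ucvM bL (bnd_ctr bL) cvL (ucv_ctr cvL).
(* The unperturbed [R_k] is inserted into the perturbed Stein operator, so that the difference of
   the two [R_k] solves a single Stein equation with vanishing right-hand side. *)
have cvTR : ucv F (fun t k => sysR A B Cc X k - T t *m sysR A B Cc X k *m (T t)^t*)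
  (fun k => sysR A B Cc X k - cay (recovered_alpha A B X) *m sysR A B Cc X k
    *m (cay (recovered_alpha A B X))^t*).
  apply: ucvB (ucv_cst _) _.
  apply: ucvM (bndM (bnd_cst _) bR) (bnd_cst _) _ (ucv_ctr cvT).
  exact: ucvM (bnd_cst _) bR cvT (ucv_cst _).
have cvD : ucv F (fun t k => sysR (At t) (Bt t) (Ct t) (Xt t) k - sysR A B Cc X k)
    (fun=> 0).
  apply: (ucv_stein stab cvT).
  apply: ucv_eq_lim (fun k => subrr _) _.
  apply: ucv_near_eq (ucvB cvF cvTR); apply: filterS sysXt => t sysXt1 k.
  have <- := steinB (T t) (sysR (At t) (Bt t) (Ct t) (Xt t) k) (sysR A B Cc X k).
  congr (_ - _); exact (esym (sysR_stein sysXt1 k)).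
have cvR : ucv F (fun t k => sysR (At t) (Bt t) (Ct t) (Xt t) k) (sysR A B Cc X).
  apply: ucv_eq_lim (fun k => add0r _) _.
  apply: ucv_near_eq (ucvD cvD (ucv_cst (sysR A B Cc X))).
  by apply: nearW => t k; rewrite subrK.
have bRi := bnd_inv_sysR sysX.
have [_ cvRi] := ucv_inv bRi (sysR_unit sysX) cvR.
have cvQ : ucv F (fun t k => sysQ (At t) (Bt t) (Ct t) (Xt t) k) (sysQ A B Cc X).
  apply: (ucvM (bndM (bnd_ctr bL) bRi) bL _ cvL).
  exact: ucvM (bnd_ctr bL) bRi (ucv_ctr cvL) cvRi.
have cvQ' : ucv F
    (fun t k => jmx R m1 m2 + sysQ (At t) (Bt t) (Ct t) (Xt t) k
      - sysQ (At t) (Bt t) (Ct t) (Xt t) k.+1)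
    (fun k => jmx R m1 m2 + sysQ A B Cc X k - sysQ A B Cc X k.+1).
  exact: ucvB (ucvD (ucv_cst (fun=> jmx R m1 m2)) cvQ) (ucv_shift cvQ).
apply: ucv_eq_lim (fun k => esym (recovered_potentialE sysX k)) _.
apply: ucv_near_eq cvQ'; apply: filterS sysXt => t sysXt1 k.
by rewrite (recovered_potentialE sysXt1).
Qed.

End Limit.
End PotentialLimit.

(** * Minimality implies controllability and observability *)

Section Kalman.
Variable R : realType.
Local Notation C := R[i].
Local Notation K := {fraction {poly C}}.

Lemma cst_mxM m n p (A : 'M[C]_(m, n)) (B : 'M[C]_(n, p)) :
  cst_mx (A *m B) = cst_mx A *m cst_mx B.
Proof. exact: (map_mxM ((@tofrac {poly C}) \o (@polyC C))). Qed.

Lemma resolvent_unit n (A : 'M[C]_n) : (tofrac 'X)%:M - cst_mx A \in unitmx.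
Proof.
have -> : (tofrac 'X)%:M - cst_mx A = map_mx (@tofrac {poly C}) (char_poly_mx A).
  by apply/matrixP=> i j; rewrite !mxE rmorphB rmorphMn.
rewrite unitmxE det_map_mx unitfE tofrac_eq0 monic_neq0 //.
exact: char_poly_monic.
Qed.

Lemma resolvent_intertwine n n' (A : 'M[C]_n) (A' : 'M[C]_n') (W : 'M[C]_(n, n')) :
  A *m W = W *m A' ->
  cst_mx W *m invmx ((tofrac 'X)%:M - cst_mx A')
  = invmx ((tofrac 'X)%:M - cst_mx A) *m cst_mx W.
Proof.
move=> AW; apply: (can_inj (mulKmx (resolvent_unit A))).
rewrite mulKVmx ?resolvent_unit // mulmxA.
apply: (can_inj (mulmxK (resolvent_unit A'))).
rewrite mulmxKV ?resolvent_unit // mulmxBl mulmxBr -!cst_mxM AW.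
by rewrite mul_scalar_mx mul_mx_scalar.
Qed.

(** If [V] is nonzero, its right kernel is stable under [A] and contains the columns of [B].
    Restricting the system to it gives a realization of [phi] of size [n - \rank V]. *)
Lemma minimal_ctrl n m1 m2 (phi : 'M[K]_(m1, m2)) (A : 'M[C]_n)
    (B : 'M[C]_(n, m2)) (Cc : 'M[C]_(m1, n)) :
  minimal_realization phi A B Cc -> controllable A B.
Proof.
move=> [phiE phi_min] p V VA VB; apply/eqP; case: (eqVneq V 0) => // V0.
pose W := (row_base (kermx V^T))^T.
have VW : V *m W = 0.
  apply: trmx_inj; rewrite trmx_mul trmxK trmx0; apply/sub_kermxP.
  by rewrite eq_row_base.
have in_W q (M : 'M[C]_(n, q)) : V *m M = 0 -> exists M', M = W *m M'.
  move=> VM; have : (M^T <= row_base (kermx V^T))%MS.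
    by rewrite eq_row_base; apply/sub_kermxP; rewrite -trmx_mul VM trmx0.
  case/submxP => D DE; exists D^T; apply: trmx_inj.
  by rewrite trmx_mul !trmxK.
have [Z VAZ] := submxP VA.
have [A' AW] : exists A', A *m W = W *m A'.
  by apply: in_W; rewrite mulmxA VAZ -mulmxA VW mulmx0.
have [B' BW] := in_W _ _ VB.
clearbody W; have := phi_min _ A' B' (Cc *m W); rewrite leqNgt => /(_ _)/negP[].
  rewrite phiE /transfer BW !cst_mxM -!mulmxA; congr (_ *m _).
  by rewrite !mulmxA (resolvent_intertwine AW).
rewrite mxrank_ker mxrank_tr.
rewrite ltn_subrL lt0n mxrank_eq0 V0 /=.
by rewrite (leq_trans _ (rank_leq_col V)) // lt0n mxrank_eq0.
Qed.

(** Here the system passes to a quotient: the rows of [W] are the coordinates that the output sees,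
    and they evolve autonomously under [A']. *)
Lemma minimal_obs n m1 m2 (phi : 'M[K]_(m1, m2)) (A : 'M[C]_n)
    (B : 'M[C]_(n, m2)) (Cc : 'M[C]_(m1, n)) :
  minimal_realization phi A B Cc -> controllable (A^t*) (Cc^t*).
Proof.
move=> [phiE phi_min] p V VA VB; apply/eqP; case: (eqVneq V 0) => // V0.
pose W := row_base (kermx (V^t*)).
have WV : W *m V^t* = 0 by apply/sub_kermxP; rewrite eq_row_base.
have in_W q (M : 'M[C]_(q, n)) : M *m V^t* = 0 -> exists M', M = M' *m W.
  by move=> MV; apply/submxP; rewrite eq_row_base; apply/sub_kermxP.
have [Z VAZ] := submxP VA.
have [A' AW] : exists A', W *m A = A' *m W.
  apply: in_W; rewrite -mulmxA.
  have -> : A *m V^t* = V^t* *m Z^t* by rewrite -ctrM -VAZ ctrM trmxCK.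
  by rewrite mulmxA WV mul0mx.
have [C' CW] : exists C', Cc = C' *m W.
  by apply: in_W; rewrite -[Cc]trmxCK -ctrM VB ctr0.
clearbody W; have := phi_min _ A' (W *m B) C'; rewrite leqNgt => /(_ _)/negP[].
  rewrite phiE /transfer {1}CW !cst_mxM -!mulmxA; congr (_ *m _).
  by rewrite !mulmxA (resolvent_intertwine (esym AW)).
rewrite mxrank_ker mxrank_map mxrank_tr.
rewrite ltn_subrL lt0n mxrank_eq0 V0 /=.
by rewrite (leq_trans _ (rank_leq_col V)) // lt0n mxrank_eq0.
Qed.

Lemma minimal_sys n m1 m2 (phi : 'M[K]_(m1, m2)) (A : 'M[C]_n)
    (B : 'M[C]_(n, m2)) (Cc : 'M[C]_(m1, n)) X :
  minimal_realization phi A B Cc -> positive_riccati_solution A B Cc X ->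
  riccati_system A B Cc X.
Proof.
move=> min_phi [Xpos ric]; split=> //.
- exact: posdef_pd.
- exact: minimal_ctrl min_phi.
- exact: minimal_obs min_phi.
Qed.

End Kalman.

(** * Comparison of the induced and entrywise norms *)

Section InducedNorm.
Variable R : realType.
Local Notation C := R[i].

Lemma vec_norm_entry n (x : 'cV[C]_n) k : normc (x k 0) <= vec_norm x.
Proof.
rewrite -(ger0_norm (normc_ge0 _)) -sqrtr_sqr ler_wsqrtr //.
rewrite (bigD1 k) //= lerDl sumr_ge0 // => l _; exact: sqr_ge0.
Qed.

Lemma vec_norm_le n (x : 'cV[C]_n) : vec_norm x <= \sum_k normc (x k 0).
Proof.
have s0 : 0 <= \sum_k normc (x k 0) by apply: sumr_ge0 => k _; apply: normc_ge0.
rewrite -(ger0_norm s0) -sqrtr_sqr ler_wsqrtr //.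
rewrite expr2 mulr_sumr ler_sum // => k _; rewrite expr2 ler_wpM2r ?normc_ge0 //.
rewrite (bigD1 k) //= lerDl sumr_ge0 // => l _; exact: normc_ge0.
Qed.

Lemma vec_norm_mul m n (A : 'M[C]_(m, n)) x : vec_norm x <= 1 ->
  vec_norm (A *m x) <= nrm A.
Proof.
move=> x1; rewrite (le_trans (vec_norm_le _)) // ler_sum // => k _.
rewrite mxE (le_trans (ler_normc_sum _ _)) // ler_sum // => j _.
rewrite normcM ler_piMr ?normc_ge0 //.
exact: le_trans (vec_norm_entry x j) x1.
Qed.

Lemma mx_norm2_set m n (A : 'M[C]_(m, n)) (x : 'cV[C]_n) : vec_norm x <= 1 ->
  vec_norm (A *m x) <= mx_norm2 A.
Proof.
move=> x1; apply: ub_le_sup; last by exists x.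
by exists (nrm A) => _ [y y1 ->]; apply: vec_norm_mul.
Qed.

Lemma vec_norm0 n : vec_norm (0 : 'cV[C]_n) = 0.
Proof.
by rewrite /vec_norm big1 ?sqrtr0 // => k _; rewrite mxE normc0 expr0n.
Qed.

Lemma mx_norm2_ge0 m n (A : 'M[C]_(m, n)) : 0 <= mx_norm2 A.
Proof.
by have := @mx_norm2_set _ _ A 0; rewrite mulmx0 !vec_norm0; apply.
Qed.

Lemma mx_norm2_le m n (A : 'M[C]_(m, n)) : mx_norm2 A <= nrm A.
Proof.
apply: ge_sup; first by exists (vec_norm (A *m 0)), 0; rewrite ?vec_norm0.
by move=> _ [x x1 ->]; apply: vec_norm_mul.
Qed.

Lemma nrm_le_mx_norm2 m n (A : 'M[C]_(m, n)) : nrm A <= m%:R * n%:R * mx_norm2 A.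
Proof.
apply: nrm_le_entries => i j; apply: le_trans (mx_norm2_set A (x := delta_mx j 0) _).
  by rewrite -colE (_ : A i j = col j A i 0) ?vec_norm_entry // mxE.
apply: (le_trans (vec_norm_le _)); rewrite (bigD1 j) //= big1 => [|k kj].
  by rewrite mxE !eqxx normc1 addr0.
by rewrite mxE (negPf kj) normc0.
Qed.

End InducedNorm.

(** * The filter of nearby data, and the conclusion *)

Section DataFilter.
Variables (R : realType) (n m1 m2 : nat).
Local Notation C := R[i].
Variables (A : 'M[C]_n) (B : 'M[C]_(n, m2)) (Cc : 'M[C]_(m1, n)).

Record data := Data {
  dA : 'M[C]_n; dB : 'M[C]_(n, m2); dC : 'M[C]_(m1, n); dX : 'M[C]_n }.

(** Closeness is imposed on the three coefficient matrices only. The component [dX] is tied to them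
    by the Riccati system alone; its convergence is what [solution_cv] proves. *)
Definition data_filter : set_system data := fun P =>
  exists2 delta : R, 0 < delta & forall t, riccati_system (dA t) (dB t) (dC t) (dX t) ->
    mx_norm2 (A - dA t) + mx_norm2 (B - dB t) + mx_norm2 (Cc - dC t) < delta -> P t.

Lemma data_filterP : Filter data_filter.
Proof.
split; first by exists 1.
  move=> P Q [d d0 dP] [e e0 eQ]; exists (Num.min d e).
    by rewrite lt_min d0.
  by move=> t st; rewrite lt_min => /andP[td te]; split; [apply: dP | apply: eQ].
by move=> P Q PQ [d d0 dP]; exists d => // t st td; apply/PQ/dP.
Qed.

Lemma ucv_of_mx_norm2 p q (M : 'M[C]_(p, q)) (N : data -> 'M[C]_(p, q)) :
  (forall t, mx_norm2 (M - N t)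
     <= mx_norm2 (A - dA t) + mx_norm2 (B - dB t) + mx_norm2 (Cc - dC t)) ->
  ucv data_filter (fun t _ => N t) (fun=> M).
Proof.
move=> MN e e0; pose k : R := p%:R * q%:R + 1.
have k0 : 0 < k by rewrite ltr_wpDl // mulr_ge0.
exists (e / k); first by rewrite divr_gt0.
move=> t _ td _; rewrite -nrmN opprB (le_trans (nrm_le_mx_norm2 _)) //.
apply: (@le_trans _ _ (k * mx_norm2 (M - N t))).
  by rewrite ler_wpM2r ?mx_norm2_ge0 // lerDl.
by rewrite mulrC -ler_pdivlMr // (le_trans (MN t)) // ltW.
Qed.

End DataFilter.

Theorem corollary4p13 (R : realType) (n m1 m2 : nat)
    (phi : 'M[{fraction {poly R[i]}}]_(m1, m2))
    (A : 'M[R[i]]_n) (B : 'M[R[i]]_(n, m2)) (Cc : 'M[R[i]]_(m1, n))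
    (X : 'M[R[i]]_n)
    (min_phi : minimal_realization phi A B Cc)
    (X_sol : positive_riccati_solution A B Cc X)
    (i_notin_spectrum : ~~ eigenvalue (recovered_alpha A B X) 'i) :
  forall eps : R, 0 < eps ->
  exists2 delta : R, 0 < delta &
  forall (phit : 'M[{fraction {poly R[i]}}]_(m1, m2))
    (At : 'M[R[i]]_n) (Bt : 'M[R[i]]_(n, m2)) (Ct : 'M[R[i]]_(m1, n))
    (Xt : 'M[R[i]]_n),
    minimal_realization phit At Bt Ct ->
    positive_riccati_solution At Bt Ct Xt ->
    mx_norm2 (A - At) + mx_norm2 (B - Bt) + mx_norm2 (Cc - Ct) < delta ->
    (ereal_sup (range (fun k : nat =>
       (mx_norm2 (recovered_potential A B Cc X k
                  - recovered_potential At Bt Ct Xt k))%:E)) < eps%:E)%E.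
Proof.
move=> eps eps0; have sysX := minimal_sys min_phi X_sol.
have FF := data_filterP A B Cc.
(* A uniform bound passes to the supremum only as a weak inequality; halving [eps] restores
   strictness. *)
have eps2 : 0 < eps / 2 by rewrite divr_gt0.
have near_sys : \forall t \near data_filter A B Cc,
    riccati_system (dA t) (dB t) (dC t) (dX t) by exists 1.
have [] := @potential_cv _ _ (data_filter A B Cc) FF _ _ _ A B Cc X
  (@dA _ _ _ _) (@dB _ _ _ _) (@dC _ _ _ _) (@dX _ _ _ _) sysX near_sys _ _ _
  (eps / 2) eps2.
- by apply: ucv_of_mx_norm2 => t; rewrite -addrA lerDl addr_ge0 ?mx_norm2_ge0.
- by apply: ucv_of_mx_norm2 => t; rewrite addrAC lerDr addr_ge0 ?mx_norm2_ge0.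
- by apply: ucv_of_mx_norm2 => t; rewrite lerDr addr_ge0 ?mx_norm2_ge0.
move=> delta delta0 dP; exists delta => // phit At Bt Ct Xt min_t sol_t dist_t.
have := dP (Data At Bt Ct Xt) (minimal_sys min_t sol_t) dist_t => /= close.
apply: (@le_lt_trans _ _ (eps / 2)%:E); last first.
  by rewrite lte_fin ltr_pdivrMr // ltr_pMr // ltr1n.
apply: ge_ereal_sup => _ [k _ <-]; rewrite lee_fin.
by rewrite (le_trans (mx_norm2_le _)) // -nrmN opprB close.
Qed.
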